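(* Consider an interior grid point $(x_i,y_j)\notin\Gamma$ such that $(x_i^*,y_j^* ):=(x_i-wh,y_j)\in\Gamma_1$ with $0<w<1$ and $(\xi,\zeta)\notin(x_i,y_j)+(-h,h)^2$. Assume that $u_p$ and $f_p$ have uniformly continuous partial derivatives of (total) orders up to four and two, respectively, in $\Omega_p$ for $p=1,2$, and that the one-dimensional functions $\phi_1$ and $\psi_1$ on $\Gamma_1$ have uniformly continuous derivatives of orders up to four and three, respectively. Let $\mathcal{L}_h$ be the discrete operator with stencil coefficients $$C_{-1,1}=C_{-1,-1}=-\frac{r_4\alpha^2+r_5\alpha}{\beta},\quad C_{0,1}=C_{0,-1}=-1,\quad C_{1,1}=C_{1,-1}=-\frac{r_6+t_1\alpha^2+r_7\alpha}{\beta},$$ $$C_{-1,0}=-\frac{r_8\alpha^2+r_9\alpha}{\beta},\quad C_{0,0}=-\frac{s_1+s_2\alpha^2+s_3\alpha}{\beta},\quad C_{1,0}=-\frac{r_{10}+r_{11}\alpha^2+r_{12}\alpha}{\beta},$$ where $\alpha:=a_1/a_2>0$, $\beta:=r_1+r_2\alpha^2+r_3\alpha>0$ and $$r_1=(2w+1)^2(w+2)(w-1)^2,\quad r_2=4w^5-4w^4+5w^3+6w^2-5w+2,\quad r_3=-8w^5+6w^3-2w^2+4,$$ $$r_4=4w^4-4w^3+w^2+1,\quad r_5=-4w^4+4w^3-w^2+1,\quad r_6=-(2w+1)^2(w-1)^3,\quad r_7=8w^5-20w^4+14w^3-3w^2+1,$$ $$r_8=-8w^4+8w^3+10w^2-6w+4,\quad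 r_9=8w^4-8w^3-10w^2+6w+4,\quad r_{10}=8w^5-16w^4+14w^3-8w^2-2w+4,$$ $$r_{11}=8w^5-24w^4+38w^3-22w^2+8w,\quad r_{12}=-16w^5+40w^4-52w^3+30w^2-6w+4,\quad t_1=-4w^5+12w^4-13w^3+8w^2-w,$$ $$s_1=-8w^5-8w^4+10w^3+26w^2-10w-10,\quad s_2=-8w^5+8w^4-22w^3-18w^2+10w-10,\quad s_3=16w^5+12w^3-8w^2-20.$$ Then the compact 9-point finite difference scheme $h^{-1}\mathcal{L}_hu_h=h^{-1}F$ has a fourth order of consistency at the grid point $(x_i,y_j)$, i.e. $h^{-1}(\mathcal{L}_hu-F)=O(h^4)$ as $h\to0$, where $$F:=\frac1{a_1}\sum_{(m,n)\in\Lambda_2}f_1^{(m,n)}H^{-,w}_{m,n}+\frac1{a_2}\sum_{(m,n)\in\Lambda_2}f_2^{(m,n)}H^{+,w}_{m,n}-\sum_{n=0}^4\phi_1^{(n)}G^w_{0,n}-\frac1{a_1}\sum_{n=0}^3\psi_1^{(n)}G^w_{1,n}.$$ Moreover, up to a multiplicative constant for normalization, these stencil coefficients are unique: any real coefficients $\{C'_{k,\ell}\}_{k,\ell=-1,0,1}$ (depending only on $a_1,a_2,w$) for which the scheme obtained by using $C'_{k,\ell}$ instead of $C_{k,\ell}$ in both $\mathcal{L}_h$ and $F$ has fourth order of consistency (for all data $u,f,\phi_1,\psi_1$ of the elliptic cross-interface problem such that $u_p$ and $f_p$ have uniformly continuous partial derivatives of (total) orders up to four and two, respectively, in $\Omega_p$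 for $p=1,2$, and $\phi_1$ and $\psi_1$ have uniformly continuous derivatives of orders up to four and three, respectively, on $\Gamma_1$) satisfy $C'_{k,\ell}=\lambda C_{k,\ell}$ for all $k,\ell$ with some $\lambda\in\mathbb{R}$.
   Context: **Problem.** Let $l_1<l_2$, $l_3<l_4$ be real with $l_4-l_3=N_0(l_2-l_1)$ for a positive integer $N_0$, let $\Omega=(l_1,l_2)\times(l_3,l_4)$ and $(\xi,\zeta)\in\Omega$. Put $\Gamma_1=\{\xi\}\times(\zeta,l_4)$, $\Gamma_2=\{\xi\}\times(l_3,\zeta)$, $\Gamma_3=(\xi,l_2)\times\{\zeta\}$, $\Gamma_4=(l_1,\xi)\times\{\zeta\}$, $\Gamma=\Gamma_1\cup\Gamma_2\cup\Gamma_3\cup\Gamma_4\cup\{(\xi,\zeta)\}$, and $\Omega_1=(l_1,\xi)\times(\zeta,l_4)$, $\Omega_2=(\xi,l_2)\times(\zeta,l_4)$, $\Omega_3=(\xi,l_2)\times(l_3,\zeta)$, $\Omega_4=(l_1,\xi)\times(l_3,\zeta)$. The coefficient $a$ equals a positive constant $a_p$ on $\Omega_p$; $u_p$ and $f_p$ denote the restrictions of $u$ and $f$ to $\Omega_p$ (with their derivatives extended continuously to $\overline{\Omega_p}$). The function $u$ is the exact solution of the elliptic cross-interface problem $$-\nabla\cdot(a\nabla u)=f\ \text{in }\Omega\setminus\Gamma,\quad [u]=\phi_p,\ [a\nabla u\cdot\vec n]=\psi_p\ \text{on }\Gamma_p\ (p=1,2,3,4),\quad u=g\ \text{on }\partial\Omega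 .$$ On $\Gamma_1,\Gamma_2$ the bracket is the limit $x\to\xi^+$ minus the limit $x\to\xi^-$ and $a\nabla u\cdot\vec n=a\,\partial u/\partial x$; on $\Gamma_3,\Gamma_4$ it is the limit $y\to\zeta^+$ minus the limit $y\to\zeta^-$ and $a\nabla u\cdot\vec n=a\,\partial u/\partial y$. **Mesh.** $x_i=l_1+ih$ ($0\le i\le N_1$), $y_j=l_3+jh$ ($0\le j\le N_2$), $h=(l_2-l_1)/N_1$, $N_2=N_0N_1$; interior grid points are those in $\Omega$. For real stencil coefficients $C_{k,\ell}$, $\mathcal{L}_hu_h:=\sum_{k,\ell=-1}^1C_{k,\ell}(u_h)_{i+k,j+\ell}$ for a grid function $u_h$, and $\mathcal{L}_hu:=\sum_{k,\ell=-1}^1C_{k,\ell}\,u(x_i+kh,y_j+\ell h)$ for the exact solution; for the grid points considered, the values for $k=-1$ are those of $u_1$ and the values for $k=0,1$ are those of $u_2$ (continuous extensions). The scheme $h^{-1}\mathcal{L}_hu_h=h^{-1}F$ has order of consistency $r$ if $h^{-1}(\mathcal{L}_hu-F)=O(h^r)$ as $h\to0$ (with $w$ fixed, constant independent of $h$ and of the grid point satisfying the stated conditions). **Notation.** At $(x_i^*,y_j^* )\in\Gamma_1$: $f_p^{(m,n)}=\frac{\partial^{m+n}f_p}{\partial x^m\partial y^n}(x_i^*,y_j^* )$, $\phi_1^{(n)}=\frac{d^n}{dy^n}\phi_1(\xi,y)|_{y=y_j^*}$, $\psi_1^{(n)}=\frac{d^n}{dy^n}\psi_1(\xi,y)|_{y=y_j^*}$.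 $\Lambda_M=\{(m,n)\in\mathbb{Z}_{\ge0}^2: m+n\le M\}$. For nonnegative integers $m,n$, $$G_{m,n}(x,y)=\sum_{\ell=0}^{\lfloor n/2\rfloor}\frac{(-1)^\ell x^{m+2\ell}y^{n-2\ell}}{(m+2\ell)!(n-2\ell)!},\qquad H_{m,n}(x,y)=\sum_{\ell=1}^{1+\lfloor n/2\rfloor}\frac{(-1)^\ell x^{m+2\ell}y^{n-2\ell+2}}{(m+2\ell)!(n-2\ell+2)!},$$ $$G^w_{m,n}=\sum_{\ell=-1}^1C_{-1,\ell}G_{m,n}(wh-h,\ell h),\quad H^{-,w}_{m,n}=\sum_{\ell=-1}^1C_{-1,\ell}H_{m,n}(wh-h,\ell h),\quad H^{+,w}_{m,n}=\sum_{k=0}^1\sum_{\ell=-1}^1C_{k,\ell}H_{m,n}(wh+kh,\ell h).$$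
   Formalization: Fourth-order derivatives of u_1, u_2 are also assumed Lipschitz (otherwise O(h^4) fails, e.g. u_2=Re z^{9/2}); uniqueness on meshes assumes such grid points exist for arbitrarily small h (otherwise it is vacuous), and is also proved for every w with a free step h. *)

(* Defs.v *)
From Stdlib Require Import Reals ZArith Lra Lia.
From Coquelicot Require Import Coquelicot.
Open Scope R_scope.

Record geometry := Geometry {
  l1 : R; l2 : R; l3 : R; l4 : R;
  xi : R; zeta : R;
  N0 : nat;
  l1_lt_l2 : l1 < l2;
  l3_lt_l4 : l3 < l4;
  N0_pos : (0 < N0)%nat;
  aspect_ratio : l4 - l3 = INR N0 * (l2 - l1);
  xi_inside : l1 < xi < l2;
  zeta_inside : l3 < zeta < l4
}.

Inductive index := I1 | I2 | I3 | I4.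

Definition Omega (G : geometry) (x y : R) : Prop :=
  l1 G < x < l2 G /\ l3 G < y < l4 G.

Definition boundary (G : geometry) (x y : R) : Prop :=
  (l1 G <= x <= l2 G /\ l3 G <= y <= l4 G) /\ ~ Omega G x y.

Definition Omega_ (G : geometry) (p : index) (x y : R) : Prop :=
  match p with
  | I1 => l1 G < x < xi G /\ zeta G < y < l4 G
  | I2 => xi G < x < l2 G /\ zeta G < y < l4 G
  | I3 => xi G < x < l2 G /\ l3 G < y < zeta G
  | I4 => l1 G < x < xi G /\ l3 G < y < zeta G
  end.

Definition Gamma_ (G : geometry) (p : index) (x y : R) : Prop :=
  match p with
  | I1 => x = xi G /\ zeta G < y < l4 G
  | I2 => x = xi G /\ l3 G < y < zeta G
  | I3 => xi G < x < l2 G /\ y = zeta G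
  | I4 => l1 G < x < xi G /\ y = zeta G
  end.

Definition Gamma (G : geometry) (x y : R) : Prop :=
  (exists p, Gamma_ G p x y) \/ (x = xi G /\ y = zeta G).

Definition dx (v : R -> R -> R) (x y : R) : R := Derive (fun t => v t y) x.
Definition dy (v : R -> R -> R) (x y : R) : R := Derive (fun t => v x t) y.

(* The value at (x, y) of the continuous extension of the restriction of v to
   D: the limit of v at (x, y) along D. *)
Definition extension (D : R -> R -> Prop) (v : R -> R -> R) (x y : R) : R :=
  iota (fun l : R =>
    filterlim (fun z : R * R => v (fst z) (snd z))
      (within (fun z : R * R => D (fst z) (snd z)) (locally (x, y)))
      (locally l)).

Definition unif_continuous (D : R -> R -> Prop) (v : R -> R -> R) : Prop :=
  forall eps, 0 < eps -> exists delta, 0 < delta /\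
    forall x y x' y', D x y -> D x' y' ->
      Rabs (x - x') < delta -> Rabs (y - y') < delta ->
      Rabs (v x y - v x' y') < eps.

(* All iterated partial derivatives of v of total order at most M exist and
   are uniformly continuous in the open set D. *)
Fixpoint unif_smooth (M : nat) (D : R -> R -> Prop) (v : R -> R -> R) : Prop :=
  unif_continuous D v /\
  match M with
  | O => True
  | S M' =>
      (forall x y, D x y ->
         ex_derive (fun t => v t y) x /\ ex_derive (fun t => v x t) y) /\
      unif_smooth M' D (dx v) /\ unif_smooth M' D (dy v)
  end.

Definition unif_smooth_1d (M : nat) (lo hi : R) (v : R -> R) : Prop :=
  forall k, (k <= M)%nat ->
    (forall t, lo < t < hi -> ex_derive_n v k t) /\
    uniform_continuity (Derive_n v k) (fun t => lo < t < hi).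

Definition lipschitz_derivatives (M : nat) (D : R -> R -> Prop)
    (v : R -> R -> R) : Prop :=
  exists L, forall m n, (m + n)%nat = M ->
    forall x y x' y', D x y -> D x' y' ->
      Rabs (partial_derive m n v x y - partial_derive m n v x' y')
        <= L * (Rabs (x - x') + Rabs (y - y')).

Definition coefficient (G : geometry) (a : R -> R -> R) (ap : index -> R)
    : Prop :=
  forall p, 0 < ap p /\ forall x y, Omega_ G p x y -> a x y = ap p.

Definition has_jump (v : R -> R) (c j : R) : Prop :=
  exists vr vl : R,
    filterlim v (at_right c) (locally vr) /\
    filterlim v (at_left c) (locally vl) /\ vr - vl = j.

(* Classical solutions.  The jump data are functions of the coordinate that
   varies along the branch: y on Gamma_1, Gamma_2 and x on Gamma_3, Gamma_4.
   The boundary values are attained continuously except at the four points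
   where the interface meets the boundary, where u may jump. *)
Record exact_solution (G : geometry) (a f : R -> R -> R)
    (phi psi : index -> R -> R) (g u : R -> R -> R) : Prop := {
  pde : forall x y, Omega G x y -> ~ Gamma G x y ->
    ex_derive (fun t => u t y) x /\ ex_derive (fun t => u x t) y /\
    ex_derive (fun t => a t y * dx u t y) x /\
    ex_derive (fun t => a x t * dy u x t) y /\
    - (Derive (fun t => a t y * dx u t y) x
       + Derive (fun t => a x t * dy u x t) y) = f x y;
  jump_vertical : forall p y, p = I1 \/ p = I2 -> Gamma_ G p (xi G) y ->
    has_jump (fun x => u x y) (xi G) (phi p y) /\
    has_jump (fun x => a x y * dx u x y) (xi G) (psi p y);
  jump_horizontal : forall p x, p = I3 \/ p = I4 -> Gamma_ G p x (zeta G) ->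
    has_jump (fun y => u x y) (zeta G) (phi p x) /\
    has_jump (fun y => a x y * dy u x y) (zeta G) (psi p x);
  dirichlet : forall x y, boundary G x y -> u x y = g x y;
  dirichlet_continuous : forall x y, boundary G x y ->
    x <> xi G -> y <> zeta G ->
    filterlim (fun z : R * R => u (fst z) (snd z))
      (within (fun z : R * R => Omega G (fst z) (snd z)) (locally (x, y)))
      (locally (g x y))
}.

Record regular_data (G : geometry) (f : R -> R -> R)
    (phi psi : index -> R -> R) (u : R -> R -> R) : Prop := {
  u_regular : forall p, p = I1 \/ p = I2 -> unif_smooth 4 (Omega_ G p) u;
  f_regular : forall p, p = I1 \/ p = I2 -> unif_smooth 2 (Omega_ G p) f;
  phi_regular : unif_smooth_1d 4 (zeta G) (l4 G) (phi I1);
  psi_regular : unif_smooth_1d 3 (zeta G) (l4 G) (psi I1);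
  (* Without this condition the truncation error divided by h is only o(h^3):
     for u_1 = 0 and u_2 = Re z^(9/2), with z centred at a base point on
     Gamma_1, a_1 = a_2 and w = 1/2, it is of exact order h^(7/2). *)
  u_top_lipschitz : forall p, p = I1 \/ p = I2 ->
    lipschitz_derivatives 4 (Omega_ G p) u
}.

Definition mesh_size (G : geometry) (N1 : nat) : R := (l2 G - l1 G) / INR N1.

(* The base point of the grid point (x, y) is (x - w h, y); the last condition
   says that the cross point is not in (x, y) + (-h, h)^2. *)
Definition mesh_point (G : geometry) (w h x y : R) : Prop :=
  (exists N1 i j : nat, (0 < N1)%nat /\ (i <= N1)%nat /\ (j <= N0 G * N1)%nat /\
     h = mesh_size G N1 /\ x = l1 G + INR i * h /\ y = l3 G + INR j * h) /\
  Omega G x y /\ ~ Gamma G x y /\ Gamma_ G I1 (x - w * h) y /\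
  ~ (Rabs (xi G - x) < h /\ Rabs (zeta G - y) < h).

(* The same configuration with an arbitrary real step: the stencil fits in the
   closed domain, but need not be aligned with a mesh of it.  If w is irrational,
   then at most one mesh of a given domain has points with this w. *)
Definition stencil_point (G : geometry) (w h x y : R) : Prop :=
  (l1 G <= x - h /\ x + h <= l2 G /\ l3 G <= y - h /\ y + h <= l4 G) /\
  Gamma_ G I1 (x - w * h) y /\
  ~ (Rabs (xi G - x) < h /\ Rabs (zeta G - y) < h).

Definition arbitrarily_fine (P : R -> R -> R -> Prop) : Prop :=
  forall delta, 0 < delta -> exists h x y, 0 < h < delta /\ P h x y.

Definition sum3 (s : Z -> R) : R := s (-1)%Z + s 0%Z + s 1%Z.

Definition Gpoly (m n : nat) (x y : R) : R :=
  sum_f_R0 (fun l : nat =>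
    (-1) ^ l * x ^ (m + 2 * l) * y ^ (n - 2 * l)
      / (INR (fact (m + 2 * l)) * INR (fact (n - 2 * l)))) (n / 2).

(* The exponent n + 2 - 2 l must not be written n - 2 l + 2, which differs from
   it for truncated subtraction. *)
Definition Hpoly (m n : nat) (x y : R) : R :=
  sum_f 1 (1 + n / 2) (fun l : nat =>
    (-1) ^ l * x ^ (m + 2 * l) * y ^ (n + 2 - 2 * l)
      / (INR (fact (m + 2 * l)) * INR (fact (n + 2 - 2 * l)))).

Definition Gw (C : Z -> Z -> R) (w h : R) (m n : nat) : R :=
  sum3 (fun l => C (-1)%Z l * Gpoly m n (w * h - h) (IZR l * h)).

Definition Hminus (C : Z -> Z -> R) (w h : R) (m n : nat) : R :=
  sum3 (fun l => C (-1)%Z l * Hpoly m n (w * h - h) (IZR l * h)).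

Definition Hplus (C : Z -> Z -> R) (w h : R) (m n : nat) : R :=
  sum3 (fun l => C 0%Z l * Hpoly m n (w * h) (IZR l * h)) +
  sum3 (fun l => C 1%Z l * Hpoly m n (w * h + h) (IZR l * h)).

Definition sum_Lambda (M : nat) (F : nat -> nat -> R) : R :=
  sum_f_R0 (fun m => sum_f_R0 (fun n => F m n) (M - m)) M.

Definition Lh (G : geometry) (C : Z -> Z -> R) (u : R -> R -> R) (h x y : R)
    : R :=
  let u1 := extension (Omega_ G I1) u in
  let u2 := extension (Omega_ G I2) u in
  sum3 (fun l => C (-1)%Z l * u1 (x - h) (y + IZR l * h)) +
  sum3 (fun l => C 0%Z l * u2 x (y + IZR l * h)) +
  sum3 (fun l => C 1%Z l * u2 (x + h) (y + IZR l * h)).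

Definition rhs (G : geometry) (C : Z -> Z -> R) (a1 a2 : R) (f : R -> R -> R)
    (phi1 psi1 : R -> R) (w h x y : R) : R :=
  let xs := x - w * h in
  let ys := y in
  let f1 m n := extension (Omega_ G I1) (partial_derive m n f) xs ys in
  let f2 m n := extension (Omega_ G I2) (partial_derive m n f) xs ys in
  / a1 * sum_Lambda 2 (fun m n => f1 m n * Hminus C w h m n)
  + / a2 * sum_Lambda 2 (fun m n => f2 m n * Hplus C w h m n)
  - sum_f_R0 (fun n => Derive_n phi1 n ys * Gw C w h 0 n) 4
  - / a1 * sum_f_R0 (fun n => Derive_n psi1 n ys * Gw C w h 1 n) 3.

(* h^{-1} (L_h u - F) = O(h^r) as h -> 0, uniformly over the configurations
   (h, x, y) satisfying P. *)
Definition consistency_order (r : nat) (P : R -> R -> R -> Prop)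
    (G : geometry) (C : Z -> Z -> R) (a1 a2 : R) (f : R -> R -> R)
    (phi1 psi1 : R -> R) (u : R -> R -> R) (w : R) : Prop :=
  exists K delta : R, 0 < delta /\
    forall h x y, 0 < h < delta -> P h x y ->
      Rabs (/ h * (Lh G C u h x y - rhs G C a1 a2 f phi1 psi1 w h x y))
        <= K * h ^ r.

Definition consistent (r : nat) (P : R -> R -> R -> Prop) (G : geometry)
    (a : R -> R -> R) (ap : index -> R) (w : R) (C : Z -> Z -> R) : Prop :=
  forall (f : R -> R -> R) (phi psi : index -> R -> R) (g u : R -> R -> R),
    exact_solution G a f phi psi g u ->
    regular_data G f phi psi u ->
    consistency_order r P G C (ap I1) (ap I2) f (phi I1) (psi I1) u w.

Definition r1 (w : R) : R := (2*w + 1)^2 * (w + 2) * (w - 1)^2.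
Definition r2 (w : R) : R := 4*w^5 - 4*w^4 + 5*w^3 + 6*w^2 - 5*w + 2.
Definition r3 (w : R) : R := -8*w^5 + 6*w^3 - 2*w^2 + 4.
Definition r4 (w : R) : R := 4*w^4 - 4*w^3 + w^2 + 1.
Definition r5 (w : R) : R := -4*w^4 + 4*w^3 - w^2 + 1.
Definition r6 (w : R) : R := - ((2*w + 1)^2 * (w - 1)^3).
Definition r7 (w : R) : R := 8*w^5 - 20*w^4 + 14*w^3 - 3*w^2 + 1.
Definition r8 (w : R) : R := -8*w^4 + 8*w^3 + 10*w^2 - 6*w + 4.
Definition r9 (w : R) : R := 8*w^4 - 8*w^3 - 10*w^2 + 6*w + 4.
Definition r10 (w : R) : R := 8*w^5 - 16*w^4 + 14*w^3 - 8*w^2 - 2*w + 4.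
Definition r11 (w : R) : R := 8*w^5 - 24*w^4 + 38*w^3 - 22*w^2 + 8*w.
Definition r12 (w : R) : R :=
  -16*w^5 + 40*w^4 - 52*w^3 + 30*w^2 - 6*w + 4.
Definition t1 (w : R) : R := -4*w^5 + 12*w^4 - 13*w^3 + 8*w^2 - w.
Definition s1 (w : R) : R := -8*w^5 - 8*w^4 + 10*w^3 + 26*w^2 - 10*w - 10.
Definition s2 (w : R) : R := -8*w^5 + 8*w^4 - 22*w^3 - 18*w^2 + 10*w - 10.
Definition s3 (w : R) : R := 16*w^5 + 12*w^3 - 8*w^2 - 20.

Definition beta (alpha w : R) : R := r1 w + r2 w * alpha^2 + r3 w * alpha.

(* Only the values at k, l in {-1, 0, 1} are used. *)
Definition stencil (alpha w : R) (k l : Z) : R :=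
  let b := beta alpha w in
  match k, Z.abs l with
  | (-1)%Z, 1%Z => - ((r4 w * alpha^2 + r5 w * alpha) / b)
  | 0%Z, 1%Z => -1
  | 1%Z, 1%Z => - ((r6 w + t1 w * alpha^2 + r7 w * alpha) / b)
  | (-1)%Z, 0%Z => - ((r8 w * alpha^2 + r9 w * alpha) / b)
  | 0%Z, 0%Z => - ((s1 w + s2 w * alpha^2 + s3 w * alpha) / b)
  | 1%Z, 0%Z => - ((r10 w + r11 w * alpha^2 + r12 w * alpha) / b)
  | _, _ => 0
  end.

Definition proportional (C' C : Z -> Z -> R) : Prop :=
  exists lambda : R, forall k l : Z,
    (-1 <= k <= 1)%Z -> (-1 <= l <= 1)%Z -> C' k l = lambda * C k l.

(* Main.v *)
Require Import Defs.
From Stdlib Require Import Reals ZArith Lra Lia.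
From Coquelicot Require Import Coquelicot.
Open Scope R_scope.

(* Taylor expansion of u_1 and u_2 at the base point, with the fourth derivatives
   Lipschitz, leaves an error O(h^5). The equation a_p (u_xx + u_yy) = - f_p removes
   every derivative with two or more x-derivatives (this is where the polynomials
   G and H come from), and the jump conditions express the remaining derivatives of
   u_1 by those of u_2. Hence L_h u - F is, up to O(h^5), a combination of the nine
   values d^n u_2 / dy^n (n <= 4) and d^(n+1) u_2 / dx dy^n (n <= 3), whose
   coefficients are homogeneous in h and linear in the stencil: its "moments".
   The stencil is fourth order consistent as soon as all moments vanish, and the
   homogeneous linear system "all moments vanish" has a one-dimensional solution
   space because its reduced determinant is -6 beta / alpha^2. Conversely, the
   harmonic functions e^y (A cos (x - xi) + B sin (x - xi)) to the right of the line
   x = xi, continued by 0 to the left, have all y-derivatives equal, so that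
   consistency on these two solutions makes a polynomial of degree at most four in
   h, whose coefficients are the moments, of size O(h^5), and all moments vanish. *)

(** * Limits at the boundary of a rectangle *)

(** Derivatives are controlled only inside the open subdomains, whereas the expansion and the jump
    conditions live on the interface. Every quantity at the base point is therefore a limit taken
    along an open rectangle: estimates are proved inside and then passed to the boundary, and one
    has to show that the trace of a derivative is the tangential derivative of a trace. Nine moments
    for nine coefficients would suggest a trivial kernel. Reflection in l splits the system
    unevenly: the four moments with odd n act on only three unknowns, while the five with even n act
    on six, which leaves one free direction. In the converse the base point moves with h, so the
    derivatives of a generic test solution would change along the way and its truncation error would
    not be a fixed polynomial in h. For the exponential solutions this dependence is one common
    factor e^y, bounded below by e^zeta, which can be divided out. *)

Definition rect (a b c d x y : R) : Prop := a < x < b /\ c < y < d.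
Definition closed_rect (a b c d x y : R) : Prop := a <= x <= b /\ c <= y <= d.

Definition adherent (D : R -> R -> Prop) (x y : R) : Prop :=
  forall delta, 0 < delta -> exists x' y',
    D x' y' /\ Rabs (x' - x) < delta /\ Rabs (y' - y) < delta.

Definition tends_to (D : R -> R -> Prop) (v : R -> R -> R) (x y l : R) : Prop :=
  forall eps, 0 < eps -> exists delta, 0 < delta /\
    forall x' y', D x' y' -> Rabs (x' - x) < delta -> Rabs (y' - y) < delta ->
      Rabs (v x' y' - l) < eps.

Lemma tends_to_filterlim (D : R -> R -> Prop) (v : R -> R -> R) (x y l : R) :
  filterlim (fun z : R * R => v (fst z) (snd z))
    (within (fun z : R * R => D (fst z) (snd z)) (locally (x, y)))
    (locally l) <-> tends_to D v x y l.
Proof.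
  split; intros H.
  - intros eps Heps.
    assert (H1 := proj1 (filterlim_locally _ l) H (mkposreal eps Heps)).
    unfold within in H1.
    apply (locally_2d_locally (fun a b => D a b -> ball l eps (v a b)) x y) in H1.
    destruct H1 as [delta H1].
    exists delta; split; [apply cond_pos|].
    intros x' y' HD Hx Hy. exact (H1 x' y' Hx Hy HD).
  - apply filterlim_locally. intros eps.
    destruct (H eps (cond_pos eps)) as [delta [Hd H1]].
    unfold within.
    apply (locally_2d_locally (fun a b => D a b -> ball l eps (v a b)) x y).
    exists (mkposreal delta Hd). intros u w Hu Hw HD. exact (H1 u w HD Hu Hw).
Qed.

Lemma tends_to_unique D v x y l l' :
  adherent D x y -> tends_to D v x y l -> tends_to D v x y l' -> l = l'.
Proof.
  intros Ha H H'. apply Rminus_diag_uniq.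
  destruct (Req_dec (l - l') 0) as [E|E]; [exact E|exfalso].
  assert (He : 0 < Rabs (l - l') / 2)
    by (apply Rabs_pos_lt in E; lra).
  destruct (H _ He) as [d [Hd H1]]. destruct (H' _ He) as [d' [Hd' H2]].
  destruct (Ha (Rmin d d')) as [x' [y' [HD [Hx Hy]]]]; [now apply Rmin_pos|].
  assert (Hl := Rmin_l d d'). assert (Hr := Rmin_r d d').
  specialize (H1 x' y' HD). specialize (H2 x' y' HD).
  assert (H3 : Rabs (l - l') <= Rabs (v x' y' - l) + Rabs (v x' y' - l')).
  { replace (l - l') with ((v x' y' - l') - (v x' y' - l)) by ring.
    unfold Rminus at 1. eapply Rle_trans; [apply Rabs_triang|].
    rewrite Rabs_Ropp. lra. }
  lra.
Qed.

Lemma extension_eq D v (x y l : R) :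
  adherent D x y -> tends_to D v x y l -> extension D v x y = l.
Proof.
  intros Ha H. unfold extension.
  refine (@iota_unique R_AbsRing R_CompleteNormedModule _ l _ _).
  - intros l' Hl'. apply (tends_to_unique D v x y); auto.
    now apply tends_to_filterlim.
  - now apply tends_to_filterlim.
Qed.

(** [extension] is a definite description, so its value is known only once a limit exists and is
    unique. Uniform continuity makes the values of [v] near the point a Cauchy family and [R] is
    complete; adherence makes the filter proper and the limit unique. *)
Lemma extension_limit D v (x y : R) :
  adherent D x y -> unif_continuous D v ->
  tends_to D v x y (extension D v x y).
Proof.
  intros Ha Hu.
  assert (HF : ProperFilter
    (within (fun z : R * R => D (fst z) (snd z)) (locally (x, y)))).
  { constructor.
    - intros P HP.
      assert (HP2 : locally_2d (fun a b => D a b -> P (a, b)) x y).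
      { apply locally_2d_locally. apply filter_imp with (2 := HP).
        intros [s t]; exact (fun h => h). }
      clear HP; rename HP2 into HP.
      destruct HP as [delta HP].
      destruct (Ha delta (cond_pos delta)) as [x' [y' [HD [Hx Hy]]]].
      exists (x', y'). now apply HP.
    - apply within_filter, locally_filter. }
  destruct (proj1 (@filterlim_locally_cauchy (R * R) R_CompleteSpace _ HF
                     (fun z => v (fst z) (snd z)))) as [l Hl].
  { intros eps. destruct (Hu eps (cond_pos eps)) as [delta [Hd H]].
    assert (Hd2 : 0 < delta / 2) by lra.
    exists (fun z => D (fst z) (snd z) /\ Rabs (fst z - x) < delta / 2
                     /\ Rabs (snd z - y) < delta / 2).
    split.
    - unfold within.
      apply (locally_2d_locally (fun a b => D a b ->
        D a b /\ Rabs (a - x) < delta / 2 /\ Rabs (b - y) < delta / 2) x y).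
      exists (mkposreal _ Hd2). simpl. tauto.
    - intros [a b] [a' b'] [H1 [H2 H3]] [H4 [H5 H6]]. simpl in *.
      change (Rabs (v a' b' - v a b) < eps). apply H; auto.
      + apply Rabs_def2 in H2. apply Rabs_def2 in H5. apply Rabs_def1; lra.
      + apply Rabs_def2 in H3. apply Rabs_def2 in H6. apply Rabs_def1; lra. }
  assert (Hl' := proj1 (tends_to_filterlim D v x y l) Hl).
  now rewrite (extension_eq D v x y l).
Qed.

Lemma tends_to_ext D v v' x y l :
  (forall x y, D x y -> v x y = v' x y) ->
  tends_to D v x y l -> tends_to D v' x y l.
Proof.
  intros He H eps Heps. destruct (H eps Heps) as [d [Hd H1]].
  exists d; split; auto. intros x' y' HD Hx Hy. rewrite <- He by exact HD. auto.
Qed.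

Lemma tends_to_plus D v v' x y l l' :
  tends_to D v x y l -> tends_to D v' x y l' ->
  tends_to D (fun x y => v x y + v' x y) x y (l + l').
Proof.
  intros H H' eps Heps.
  destruct (H (eps / 2)) as [d [Hd H1]]; [lra|].
  destruct (H' (eps / 2)) as [d' [Hd' H2]]; [lra|].
  assert (Hl := Rmin_l d d'). assert (Hr := Rmin_r d d').
  exists (Rmin d d'); split; [now apply Rmin_pos|].
  intros x' y' HD Hx Hy.
  specialize (H1 x' y' HD). specialize (H2 x' y' HD).
  replace (v x' y' + v' x' y' - (l + l'))
    with ((v x' y' - l) + (v' x' y' - l')) by ring.
  eapply Rle_lt_trans; [apply Rabs_triang|]. lra.
Qed.

Lemma tends_to_scal D v x y l k :
  tends_to D v x y l -> tends_to D (fun x y => k * v x y) x y (k * l).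
Proof.
  intros H eps Heps. assert (Hk := Rabs_pos k).
  destruct (H (eps / (Rabs k + 1))) as [d [Hd H1]].
  { apply Rdiv_lt_0_compat; lra. }
  exists d; split; auto. intros x' y' HD Hx Hy.
  rewrite <- Rmult_minus_distr_l, Rabs_mult.
  specialize (H1 x' y' HD Hx Hy).
  apply Rle_lt_trans with ((Rabs k) * (eps / (Rabs k + 1))).
  - apply Rmult_le_compat_l; lra.
  - apply Rlt_le_trans with ((Rabs k + 1) * (eps / (Rabs k + 1))).
    + apply Rmult_lt_compat_r; [apply Rdiv_lt_0_compat|]; lra.
    + right. field. lra.
Qed.

Lemma tends_to_seq D v x y l (X Y : nat -> R) :
  tends_to D v x y l -> (forall n, D (X n) (Y n)) ->
  is_lim_seq X x -> is_lim_seq Y y ->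
  is_lim_seq (fun n => v (X n) (Y n)) l.
Proof.
  intros H HD HX HY. apply is_lim_seq_spec. intros eps.
  destruct (H eps (cond_pos eps)) as [d [Hd H1]].
  apply is_lim_seq_spec in HX. apply is_lim_seq_spec in HY.
  generalize (filter_and _ _ (HX (mkposreal d Hd)) (HY (mkposreal d Hd))).
  apply filter_imp. intros n [Hx Hy]. now apply H1.
Qed.

(** The ratio of the move from p towards c lies strictly between 0 and 1 for every n and tends to 0.
    A point of a closed rectangle thus becomes the limit of a sequence lying entirely in the open
    one, as [tends_to_seq] demands. *)
Definition contract (p c : R) (n : nat) : R := p + / (INR n + 2) * (c - p).

Lemma contract_lim (p c : R) : is_lim_seq (contract p c) p.
Proof.
  unfold contract.
  evar_last.
  { apply is_lim_seq_plus'; [apply is_lim_seq_const|].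
    apply is_lim_seq_mult'; [|apply is_lim_seq_const].
    apply (is_lim_seq_inv (fun n => INR n + 2) p_infty).
    - apply (is_lim_seq_plus _ _ p_infty 2); [apply is_lim_seq_INR
        |apply is_lim_seq_const|reflexivity].
    - discriminate. }
  simpl. apply f_equal. ring.
Qed.

Lemma contract_range p c n a b :
  a < c < b -> a <= p <= b -> a < contract p c n < b.
Proof.
  intros Hc Hp. unfold contract. assert (Hn := pos_INR n).
  assert (H1 : 0 < / (INR n + 2)) by (apply Rinv_0_lt_compat; lra).
  assert (H2 : / (INR n + 2) < 1).
  { rewrite <- Rinv_1. apply Rinv_lt_contravar; lra. }
  set (t := / (INR n + 2)) in *.
  replace (p + t * (c - p)) with ((1 - t) * p + t * c) by ring.
  split; nra.
Qed.

Lemma rect_adherent a b c d x y :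
  a < b -> c < d -> closed_rect a b c d x y -> adherent (rect a b c d) x y.
Proof.
  intros Hab Hcd [Hx Hy] delta Hdelta.
  assert (HX := contract_lim x ((a + b) / 2)).
  assert (HY := contract_lim y ((c + d) / 2)).
  apply is_lim_seq_spec in HX. apply is_lim_seq_spec in HY.
  destruct (filter_and _ _ (HX (mkposreal delta Hdelta))
              (HY (mkposreal delta Hdelta))) as [N HN].
  destruct (HN N (Nat.le_refl N)) as [H1 H2].
  eexists; eexists; split; [|split; [exact H1|exact H2]].
  split; apply contract_range; lra.
Qed.

(** * Taylor expansion up to the boundary *)

(** Some goals are equalities in the carrier of an algebraic structure; restated over [R] they are
    accepted by [field]. *)
Ltac as_real_eq := match goal with |- ?l = ?r => change (@eq R l r) end.

Lemma unif_smooth_continuous M D u : unif_smooth M D u -> unif_continuous D u.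
Proof. destruct M; intros [H _]; exact H. Qed.

Lemma unif_smooth_S M D u : unif_smooth (S M) D u -> unif_smooth M D u.
Proof.
  revert u; induction M as [|M IH]; intros u [Hc [Hd [Hx Hy]]].
  - now split.
  - split; [exact Hc|]. split; [exact Hd|]. split; now apply IH.
Qed.

Lemma unif_smooth_le M M' D u :
  (M' <= M)%nat -> unif_smooth M D u -> unif_smooth M' D u.
Proof.
  induction 1 as [|M HM IH]; auto. intros H. now apply IH, unif_smooth_S.
Qed.

Lemma unif_smooth_partial m n M D u :
  unif_smooth (m + n + M) D u -> unif_smooth M D (partial_derive m n u).
Proof.
  revert M. induction m as [|m IH].
  - induction n as [|n IH]; intros M H; [exact H|].
    change (unif_smooth M D (dy (partial_derive 0 n u))).
    assert (H1 : unif_smooth (S M) D (partial_derive 0 n u)).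
    { apply IH. now replace (0 + n + S M)%nat with (0 + S n + M)%nat by lia. }
    apply H1.
  - intros M H. change (unif_smooth M D (dx (partial_derive m n u))).
    assert (H1 : unif_smooth (S M) D (partial_derive m n u)).
    { apply IH. now replace (m + n + S M)%nat with (S m + n + M)%nat by lia. }
    apply H1.
Qed.

Lemma is_derive_dx M D v x y :
  unif_smooth (S M) D v -> D x y -> is_derive (fun t => v t y) x (dx v x y).
Proof. intros [_ [Hd _]] HD. apply Derive_correct, (proj1 (Hd x y HD)). Qed.

Lemma is_derive_dy M D v x y :
  unif_smooth (S M) D v -> D x y -> is_derive (fun t => v x t) y (dy v x y).
Proof. intros [_ [Hd _]] HD. apply Derive_correct, (proj2 (Hd x y HD)). Qed.

Lemma is_derive_taylor_poly (A : nat -> R) (s t : R) n :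
  is_derive (fun t => sum_f_R0 (fun k => A k * (t - s) ^ k / INR (fact k)) (S n)) t
    (sum_f_R0 (fun k => A (S k) * (t - s) ^ k / INR (fact k)) n).
Proof.
  induction n as [|n IH].
  - simpl. auto_derive; auto. field.
  - set (F := fun k t => A k * (t - s) ^ k / INR (fact k)).
    apply (is_derive_ext (fun t => sum_f_R0 (fun k => F k t) (S n) + F (S (S n)) t)).
    { intros u. reflexivity. }
    rewrite (tech5 _ n).
    apply (is_derive_plus (K := R_AbsRing) (V := R_NormedModule)); [exact IH|].
    unfold F.
    evar_last.
    { apply (is_derive_ext (fun t => A (S (S n)) / INR (fact (S (S n))) * (t - s) ^ (S (S n)))).
      { intros u. as_real_eq. field. apply INR_fact_neq_0. }
      apply is_derive_scal, is_derive_pow.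
      apply (is_derive_minus (K := R_AbsRing) (V := R_NormedModule)).
      - apply is_derive_id.
      - apply is_derive_const. }
    unfold minus, plus, opp, zero, one; simpl Nat.pred; simpl AbelianMonoid.zero.
    rewrite (fact_simpl (S n)), mult_INR. simpl AbelianMonoid.zero.
    cbn -[INR fact pow].
    field. split; [apply INR_fact_neq_0|apply not_0_INR; lia].
Qed.

(** Induction on n: the derivative of the remainder of [F] is the remainder, one order lower, of the
    shifted family, and the mean value theorem carries its bound over. The factorial is given up in
    the constant. [F] is any chain of derivatives, so that it can run through partial derivatives
    along either axis. *)
Lemma taylor_lipschitz (lo hi L : R) n : 0 <= L ->
  forall F : nat -> R -> R,
  (forall k t, (k < n)%nat -> lo < t < hi -> is_derive (F k) t (F (S k) t)) ->
  (forall s t, lo < s < hi -> lo < t < hi ->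
     Rabs (F n t - F n s) <= L * Rabs (t - s)) ->
  forall s t, lo < s < hi -> lo < t < hi ->
    Rabs (F O t - sum_f_R0 (fun k => F k s * (t - s) ^ k / INR (fact k)) n)
      <= L * Rabs (t - s) ^ S n.
Proof.
  intros HL. induction n as [|n IH]; intros F HF HLip s t Hs Ht.
  - simpl. replace (F 0%nat s * 1 / 1) with (F 0%nat s) by field.
    rewrite Rmult_1_r. now apply HLip.
  - set (rho := fun t => F O t
      - sum_f_R0 (fun k => F k s * (t - s) ^ k / INR (fact k)) (S n)).
    set (drho := fun t => F 1%nat t
      - sum_f_R0 (fun k => F (S k) s * (t - s) ^ k / INR (fact k)) n).
    assert (Hd : forall c, lo < c < hi -> is_derive rho c (drho c)).
    { intros c Hc.
      apply (is_derive_minus (K := R_AbsRing) (V := R_NormedModule)).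
      - apply HF; [lia|exact Hc].
      - apply (is_derive_taylor_poly (fun k => F k s)). }
    assert (Hlo : lo < Rmin s t) by (apply Rmin_glb_lt; lra).
    assert (Hhi : Rmax s t < hi) by (apply Rmax_lub_lt; lra).
    destruct (MVT_gen rho s t drho) as [c [Hc E]].
    { intros c Hc. apply Hd. lra. }
    { intros c Hc. apply continuity_pt_filterlim.
      apply (ex_derive_continuous (K := R_AbsRing) (V := R_NormedModule)).
      eexists. apply Hd. lra. }
    assert (Hrs : rho s = 0).
    { unfold rho.
      rewrite (sum_eq _ (fun k => if k then F O s else 0)).
      - rewrite decomp_sum by lia. rewrite (sum_eq_R0 _ (Nat.pred (S n))); [ring|auto].
      - intros [|k] _.
        + simpl. field.
        + rewrite Rminus_diag. simpl. unfold Rdiv. ring. }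
    change (Rabs (rho t) <= L * Rabs (t - s) ^ S (S n)).
    replace (rho t) with (drho c * (t - s)) by lra.
    rewrite Rabs_mult.
    assert (H1 : Rabs (drho c) <= L * Rabs (c - s) ^ S n).
    { apply (IH (fun k => F (S k))); auto; try lra.
      intros k u Hk Hu. apply HF; [lia|exact Hu]. }
    assert (H2 : Rabs (c - s) <= Rabs (t - s)).
    { revert Hc. unfold Rmin, Rmax. destruct (Rle_dec s t); intros Hc;
        unfold Rabs; repeat destruct Rcase_abs; lra. }
    assert (H3 : Rabs (c - s) ^ S n <= Rabs (t - s) ^ S n)
      by (apply pow_incr; split; [apply Rabs_pos|exact H2]).
    rewrite <- (tech_pow_Rmult _ (S n)).
    assert (H4 := Rabs_pos (t - s)).
    apply Rle_trans with (L * Rabs (c - s) ^ S n * Rabs (t - s)).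
    + now apply Rmult_le_compat_r.
    + rewrite (Rmult_comm (Rabs (t - s))), <- Rmult_assoc.
      apply Rmult_le_compat_r; auto. now apply Rmult_le_compat_l.
Qed.

Lemma lipschitz_derivatives_nonneg M D u :
  lipschitz_derivatives M D u -> exists L, 0 <= L /\
    forall m n, (m + n)%nat = M ->
    forall x y x' y', D x y -> D x' y' ->
      Rabs (partial_derive m n u x y - partial_derive m n u x' y')
        <= L * (Rabs (x - x') + Rabs (y - y')).
Proof.
  intros [L HL]. exists (Rmax L 0). split; [apply Rmax_r|].
  intros m n Hmn x y x' y' H H'. eapply Rle_trans; [now apply HL|].
  apply Rmult_le_compat_r; [|apply Rmax_l].
  assert (H1 := Rabs_pos (x - x')). assert (H2 := Rabs_pos (y - y')). lra.
Qed.

Lemma inv_INR_fact_le_1 n : 0 < / INR (fact n) <= 1.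
Proof.
  assert (H : 1 <= INR (fact n)).
  { replace 1 with (INR 1) by reflexivity. apply le_INR.
    generalize (lt_O_fact n). lia. }
  split; [apply Rinv_0_lt_compat; lra|].
  rewrite <- Rinv_1. apply Rinv_le_contravar; lra.
Qed.

(** The y-order n is the first index, so that the outer sum of [sum_Lambda] runs over it: the
    expansion is made in y first, and each of its coefficients is then expanded in x. *)
Definition taylor_term (J : nat -> nat -> R) (X Y : R) (n m : nat) : R :=
  J m n * X ^ m / INR (fact m) * Y ^ n / INR (fact n).

(** Two one-dimensional expansions along the path from (x, y) to (x, y0) to (x0, y0), which stays in
    the rectangle. The first contributes one error L r^(M+1), and the expansion of each of the M + 1
    coefficients another one, whence the factor M + 2. *)
Lemma rect_taylor a b c d u M L r x0 y0 x y : 0 <= L ->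
  unif_smooth M (rect a b c d) u ->
  (forall m n, (m + n)%nat = M ->
    forall x y x' y', rect a b c d x y -> rect a b c d x' y' ->
      Rabs (partial_derive m n u x y - partial_derive m n u x' y')
        <= L * (Rabs (x - x') + Rabs (y - y'))) ->
  rect a b c d x0 y0 -> rect a b c d x y ->
  Rabs (x - x0) <= r -> Rabs (y - y0) <= r ->
  Rabs (u x y - sum_Lambda M
    (taylor_term (fun m n => partial_derive m n u x0 y0) (x - x0) (y - y0)))
    <= (INR M + 2) * L * r ^ S M.
Proof.
  intros HL Hs HLip [Hx0 Hy0] [Hx Hy] Hrx Hry.
  assert (Hr : 0 <= r) by (generalize (Rabs_pos (x - x0)); lra).
  set (P := sum_f_R0 (fun n => partial_derive 0 n u x y0 * (y - y0) ^ n
                               / INR (fact n)) M).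
  assert (H1 : Rabs (u x y - P) <= L * r ^ S M).
  { apply Rle_trans with (L * Rabs (y - y0) ^ S M).
    - apply (taylor_lipschitz c d L M HL (fun n t => partial_derive 0 n u x t));
        auto.
      + intros k t Hk Ht.
        apply (is_derive_dy (M - k - 1) (rect a b c d)); [|now split].
        apply (unif_smooth_partial 0 k).
        now replace (0 + k + S (M - k - 1))%nat with M by lia.
      + intros s t Hs' Ht.
        eapply Rle_trans; [apply (HLip 0%nat M)|]; auto; try (now split).
        rewrite Rminus_diag, Rabs_R0. right; ring.
    - apply Rmult_le_compat_l; auto. apply pow_incr. split; auto. apply Rabs_pos. }
  assert (H2 : forall n, (n <= M)%nat ->
    Rabs (partial_derive 0 n u x y0 - sum_f_R0 (fun m =>
       partial_derive m n u x0 y0 * (x - x0) ^ m / INR (fact m)) (M - n))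
     <= L * r ^ S (M - n)).
  { intros n Hn.
    apply Rle_trans with (L * Rabs (x - x0) ^ S (M - n)).
    - apply (taylor_lipschitz a b L (M - n) HL
               (fun m t => partial_derive m n u t y0)); auto.
      + intros k t Hk Ht.
        apply (is_derive_dx (M - n - k - 1) (rect a b c d)); [|now split].
        apply (unif_smooth_partial k n).
        now replace (k + n + S (M - n - k - 1))%nat with M by lia.
      + intros s t Hs' Ht.
        eapply Rle_trans; [apply (HLip (M - n)%nat n)|]; try (now split).
        * lia.
        * rewrite Rminus_diag, Rabs_R0. right; ring.
    - apply Rmult_le_compat_l; auto. apply pow_incr. split; auto. apply Rabs_pos. }
  replace (u x y - _) with ((u x y - P) + (P - sum_Lambda M
    (taylor_term (fun m n => partial_derive m n u x0 y0) (x - x0) (y - y0))))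
    by ring.
  eapply Rle_trans; [apply Rabs_triang|].
  assert (H3 : Rabs (P - sum_Lambda M
    (taylor_term (fun m n => partial_derive m n u x0 y0) (x - x0) (y - y0)))
    <= sum_f_R0 (fun _ => L * r ^ S M) M).
  { unfold P, sum_Lambda. rewrite <- minus_sum.
    eapply Rle_trans; [apply Rsum_abs|]. apply sum_Rle. intros n Hn.
    specialize (H2 n Hn).
    replace (_ - _) with
      ((partial_derive 0 n u x y0 - sum_f_R0 (fun m =>
       partial_derive m n u x0 y0 * (x - x0) ^ m / INR (fact m)) (M - n))
       * (/ INR (fact n) * (y - y0) ^ n)).
    2:{ unfold taylor_term, Rdiv.
        rewrite (sum_eq (fun n0 => partial_derive n0 n u x0 y0 * (x - x0) ^ n0 *
            / INR (fact n0) * (y - y0) ^ n * / INR (fact n))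
          (fun m => partial_derive m n u x0 y0 * (x - x0) ^ m * / INR (fact m)
              * (/ INR (fact n) * (y - y0) ^ n))) by (intros; ring).
        rewrite <- scal_sum. ring. }
    rewrite Rabs_mult.
    apply Rle_trans with (L * r ^ S (M - n) * r ^ n).
    - apply Rmult_le_compat; auto; try apply Rabs_pos.
      rewrite Rabs_mult, <- RPow_abs.
      destruct (inv_INR_fact_le_1 n) as [Hf1 Hf2].
      rewrite (Rabs_pos_eq (/ _)) by lra.
      replace (r ^ n) with (1 * r ^ n) by ring.
      apply Rmult_le_compat; auto; try lra.
      + apply pow_le, Rabs_pos.
      + apply pow_incr. split; auto. apply Rabs_pos.
    - rewrite Rmult_assoc, <- pow_add. right. do 2 f_equal. lia. }
  rewrite sum_cte in H3. rewrite S_INR in H3. lra.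
Qed.

(* Contracting both points towards the centre by the same ratio keeps them inside
   and scales their difference, so the interior estimate passes to the limit. *)
Lemma extension_taylor a b c d u M L r x0 y0 x y : 0 <= L -> a < b -> c < d ->
  unif_smooth M (rect a b c d) u ->
  (forall m n, (m + n)%nat = M ->
    forall x y x' y', rect a b c d x y -> rect a b c d x' y' ->
      Rabs (partial_derive m n u x y - partial_derive m n u x' y')
        <= L * (Rabs (x - x') + Rabs (y - y'))) ->
  closed_rect a b c d x0 y0 -> closed_rect a b c d x y ->
  Rabs (x - x0) <= r -> Rabs (y - y0) <= r ->
  Rabs (extension (rect a b c d) u x y - sum_Lambda M
    (taylor_term (fun m n => extension (rect a b c d) (partial_derive m n u) x0 y0)
       (x - x0) (y - y0)))
    <= (INR M + 2) * L * r ^ S M.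
Proof.
  intros HL Hab Hcd Hs HLip H0 H1 Hx Hy.
  set (D := rect a b c d) in *.
  assert (Hin : forall p q, closed_rect a b c d p q -> forall n,
    D (contract p ((a + b) / 2) n) (contract q ((c + d) / 2) n)).
  { intros p q [Hp Hq] n. split; apply contract_range; lra. }
  assert (Hlim : forall v p q, unif_continuous D v -> closed_rect a b c d p q ->
    is_lim_seq (fun n => v (contract p ((a + b) / 2) n) (contract q ((c + d) / 2) n))
      (extension D v p q)).
  { intros v p q Hv Hpq. apply tends_to_seq with D p q.
    - apply extension_limit; [now apply rect_adherent|exact Hv].
    - now apply Hin.
    - apply contract_lim.
    - apply contract_lim. }
  assert (Hc : forall p p' q n, Rabs (p - p') <= r ->
    Rabs (contract p q n - contract p' q n) <= r).
  { intros p p' q n Hp. unfold contract. assert (Hn := pos_INR n).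
    assert (Ht1 : 0 < / (INR n + 2)) by (apply Rinv_0_lt_compat; lra).
    assert (Ht2 : / (INR n + 2) < 1)
      by (rewrite <- Rinv_1; apply Rinv_lt_contravar; lra).
    set (t := / (INR n + 2)) in *.
    replace (_ - _) with ((1 - t) * (p - p')) by ring.
    rewrite Rabs_mult, (Rabs_pos_eq (1 - t)) by lra.
    generalize (Rabs_pos (p - p')). nra. }
  set (X0 := contract x0 ((a + b) / 2)). set (Y0 := contract y0 ((c + d) / 2)).
  set (X1 := contract x ((a + b) / 2)). set (Y1 := contract y ((c + d) / 2)).
  assert (Hsum : forall (s : nat -> nat -> R) (l : nat -> R) N,
    (forall k, (k <= N)%nat -> is_lim_seq (s k) (l k)) ->
    is_lim_seq (fun n => sum_f_R0 (fun k => s k n) N) (sum_f_R0 l N)).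
  { intros s l N. induction N as [|N IH]; intros H; simpl.
    - now apply H.
    - apply is_lim_seq_plus'; [apply IH; intros; apply H; lia|now apply H]. }
  refine (is_lim_seq_le
    (fun n => Rabs (u (X1 n) (Y1 n) - sum_Lambda M
       (taylor_term (fun p q => partial_derive p q u (X0 n) (Y0 n))
          (X1 n - X0 n) (Y1 n - Y0 n))))
    (fun _ => (INR M + 2) * L * r ^ S M) (Finite _) (Finite _) _ _
    (is_lim_seq_const _)).
  - intros n. apply (rect_taylor a b c d); auto; try (now apply Hin); now apply Hc.
  - apply (is_lim_seq_abs _ (Finite _)), is_lim_seq_minus'.
    + apply Hlim; auto. now apply unif_smooth_continuous in Hs.
    + assert (Hpow : forall k (S T : nat -> R) (s t : R), is_lim_seq S s -> is_lim_seq T t ->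
        is_lim_seq (fun n => (S n - T n) ^ k) ((s - t) ^ k)).
      { intros k S T s t HS HT. induction k as [|k IH]; simpl.
        - apply is_lim_seq_const.
        - apply is_lim_seq_mult'; [now apply is_lim_seq_minus'|exact IH]. }
      unfold sum_Lambda.
      refine (Hsum (fun k n => sum_f_R0 _ (M - k)) (fun k => _) M _).
      intros k Hk.
      refine (Hsum (fun m n => _) (fun m => _) (M - k)%nat _). intros m Hm.
      unfold taylor_term, Rdiv.
      apply is_lim_seq_mult'; [|apply is_lim_seq_const].
      apply is_lim_seq_mult'; [|apply Hpow; apply contract_lim].
      apply is_lim_seq_mult'; [|apply is_lim_seq_const].
      apply is_lim_seq_mult'; [|apply Hpow; apply contract_lim].
      apply Hlim; auto.
      apply unif_smooth_continuous with (M - m - k)%nat.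
      apply unif_smooth_partial.
      now replace (m + k + (M - m - k))%nat with M by lia.
Qed.

(** * Commuting derivatives, one-sided limits and jumps *)

Lemma interval_locally (a b x : R) :
  a < x < b -> locally x (fun t => a < t < b).
Proof.
  intros H. apply (open_and (fun t => a < t) (fun t => t < b)); auto.
  - apply open_gt.
  - apply open_lt.
Qed.

Lemma rect_locally_2d a b c d x y :
  rect a b c d x y -> locally_2d (rect a b c d) x y.
Proof.
  intros [Hx Hy].
  destruct (interval_locally a b x Hx) as [e He].
  destruct (interval_locally c d y Hy) as [e' He'].
  exists (mkposreal _ (Rmin_pos _ _ (cond_pos e) (cond_pos e'))). simpl.
  intros u v Hu Hv. assert (H1 := Rmin_l e e'). assert (H2 := Rmin_r e e').
  split; [apply He|apply He']; unfold ball; simpl; unfold AbsRing_ball; simpl;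
    unfold abs, minus, plus, opp; simpl; unfold Rminus in *; lra.
Qed.

Lemma dx_ext a b c d v v' x y :
  (forall x y, rect a b c d x y -> v x y = v' x y) ->
  rect a b c d x y -> dx v x y = dx v' x y.
Proof.
  intros He [Hx Hy]. apply Derive_ext_loc.
  apply (filter_imp (fun t => a < t < b)); [|now apply interval_locally].
  intros t Ht. now apply He.
Qed.

Lemma dy_ext a b c d v v' x y :
  (forall x y, rect a b c d x y -> v x y = v' x y) ->
  rect a b c d x y -> dy v x y = dy v' x y.
Proof.
  intros He [Hx Hy]. apply Derive_ext_loc.
  apply (filter_imp (fun t => c < t < d)); [|now apply interval_locally].
  intros t Ht. now apply He.
Qed.

Lemma partial_derive_ext a b c d v v' m n :
  (forall x y, rect a b c d x y -> v x y = v' x y) ->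
  forall x y, rect a b c d x y -> partial_derive m n v x y = partial_derive m n v' x y.
Proof.
  intros He. induction m as [|m IH].
  - induction n as [|n IH]; [exact He|].
    intros x y Hxy.
    exact (dy_ext a b c d (partial_derive 0 n v) (partial_derive 0 n v') x y IH Hxy).
  - intros x y Hxy.
    exact (dx_ext a b c d (partial_derive m n v) (partial_derive m n v') x y IH Hxy).
Qed.

Lemma unif_continuous_ext D v v' :
  (forall x y, D x y -> v x y = v' x y) ->
  unif_continuous D v -> unif_continuous D v'.
Proof.
  intros He H eps Heps. destruct (H eps Heps) as [d [Hd H1]].
  exists d; split; auto. intros. rewrite <- !He by assumption. auto.
Qed.

Lemma unif_smooth_ext M a b c d v v' :
  (forall x y, rect a b c d x y -> v x y = v' x y) ->
  unif_smooth M (rect a b c d) v -> unif_smooth M (rect a b c d) v'.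
Proof.
  revert v v'. induction M as [|M IH]; intros v v' He H.
  - split; auto. now apply unif_continuous_ext with v, H.
  - destruct H as [Hc [Hd [Hx Hy]]].
    split; [now apply unif_continuous_ext with v|].
    split; [|split].
    + intros x y [Hxx Hyy].
      destruct (Hd x y (conj Hxx Hyy)) as [H1 H2]. split.
      * apply (ex_derive_ext_loc (fun t => v t y)); [|exact H1].
        apply (filter_imp (fun t => a < t < b)); [|now apply interval_locally].
        intros t Ht. now apply He.
      * apply (ex_derive_ext_loc (fun t => v x t)); [|exact H2].
        apply (filter_imp (fun t => c < t < d)); [|now apply interval_locally].
        intros t Ht. now apply He.
    + apply (IH (dx v)); [|exact Hx]. intros; now apply (dx_ext a b c d).
    + apply (IH (dy v)); [|exact Hy]. intros; now apply (dy_ext a b c d).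
Qed.

Lemma unif_continuous_pt a b c d v x y :
  unif_continuous (rect a b c d) v -> rect a b c d x y -> continuity_2d_pt v x y.
Proof.
  intros H Hxy eps.
  destruct (H eps (cond_pos eps)) as [e [He H1]].
  destruct (rect_locally_2d _ _ _ _ _ _ Hxy) as [e' H2].
  exists (mkposreal _ (Rmin_pos _ _ He (cond_pos e'))). simpl.
  intros s t Hs Ht. assert (Hl := Rmin_l e e'). assert (Hr := Rmin_r e e').
  apply H1; auto; try lra. apply H2; lra.
Qed.

Lemma dx_dy_comm a b c d v x y :
  unif_smooth 2 (rect a b c d) v -> rect a b c d x y ->
  dx (dy v) x y = dy (dx v) x y.
Proof.
  intros [_ [Hd [Hx Hy]]] Hxy.
  apply Schwarz.
  - destruct (rect_locally_2d _ _ _ _ _ _ Hxy) as [e He]. exists e.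
    intros s t Hs Ht. specialize (He s t Hs Ht).
    split; [apply (proj1 (Hd s t He))|]. split; [apply (proj2 (Hd s t He))|].
    split.
    + apply (proj1 (proj1 (proj2 Hy) s t He)).
    + apply (proj2 (proj1 (proj2 Hx) s t He)).
  - apply (unif_continuous_pt a b c d (dx (dy v))); auto.
    apply (unif_smooth_continuous 0), Hy.
  - apply (unif_continuous_pt a b c d (dy (dx v))); auto.
    apply (unif_smooth_continuous 0), Hx.
Qed.

(** [partial_derive] differentiates in y first and in x last. An innermost [dy] or an outermost [dx]
    is absorbed without any regularity, but an innermost [dx] has to be moved past the n derivatives
    in y one at a time, by Schwarz. *)
Lemma partial_derive_dx a b c d v m n :
  unif_smooth (m + n + 1) (rect a b c d) v ->
  forall x y, rect a b c d x y ->
    partial_derive m n (dx v) x y = partial_derive (S m) n v x y.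
Proof.
  intros Hv. induction m as [|m IH].
  - induction n as [|n IH]; [reflexivity|].
    intros x y Hxy.
    transitivity (dy (partial_derive 1 n v) x y).
    + apply (dy_ext a b c d (partial_derive 0 n (dx v))); auto.
      apply IH. now apply unif_smooth_S.
    + symmetry. apply (dx_dy_comm a b c d (partial_derive 0 n v)); auto.
      apply (unif_smooth_partial 0 n).
      now replace (0 + n + 2)%nat with (0 + S n + 1)%nat by lia.
  - intros x y Hxy.
    apply (dx_ext a b c d (partial_derive m n (dx v)) (partial_derive (S m) n v)); auto.
    apply IH. now apply unif_smooth_S.
Qed.

Lemma partial_derive_dy v m n x y :
  partial_derive m n (dy v) x y = partial_derive m (S n) v x y.
Proof.
  unfold partial_derive. apply Derive_n_ext. intros t.
  change (dy v t) with (fun z => Derive_n (fun z => v t z) 1 z).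
  rewrite Derive_n_comp. now rewrite Nat.add_1_r.
Qed.

Lemma partial_derive_lin a b c d v v' k m n :
  unif_smooth (m + n) (rect a b c d) v -> unif_smooth (m + n) (rect a b c d) v' ->
  forall x y, rect a b c d x y ->
    partial_derive m n (fun x y => k * (v x y + v' x y)) x y
    = k * (partial_derive m n v x y + partial_derive m n v' x y).
Proof.
  intros Hv Hv'. induction m as [|m IH].
  - induction n as [|n IH]; [reflexivity|].
    intros x y Hxy.
    transitivity (dy (fun x y => k * (partial_derive 0 n v x y
                                      + partial_derive 0 n v' x y)) x y).
    + apply (dy_ext a b c d (partial_derive 0 n (fun x y => k * (v x y + v' x y)))); auto.
      apply IH; now apply unif_smooth_S.
    + apply is_derive_unique.
      apply (is_derive_scal (fun t => partial_derive 0 n v x t + partial_derive 0 n v' x t)).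
      apply (is_derive_plus (K := R_AbsRing) (V := R_NormedModule));
        apply (is_derive_dy 0 (rect a b c d)); auto;
        apply (unif_smooth_partial 0 n); now rewrite Nat.add_1_r.
  - intros x y Hxy.
    transitivity (dx (fun x y => k * (partial_derive m n v x y
                                      + partial_derive m n v' x y)) x y).
    + apply (dx_ext a b c d (partial_derive m n (fun x y => k * (v x y + v' x y)))); auto.
      apply IH; now apply unif_smooth_S.
    + apply is_derive_unique.
      apply (is_derive_scal (fun t => partial_derive m n v t y + partial_derive m n v' t y)).
      apply (is_derive_plus (K := R_AbsRing) (V := R_NormedModule));
        apply (is_derive_dx 0 (rect a b c d)); auto;
        apply (unif_smooth_partial m n); now rewrite Nat.add_1_r.
Qed.

Lemma partial_derive_poisson a b c d u f k M m n : (m + n + 2 <= M)%nat ->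
  unif_smooth M (rect a b c d) u ->
  (forall x y, rect a b c d x y -> f x y = k * (dx (dx u) x y + dy (dy u) x y)) ->
  forall x y, rect a b c d x y ->
    partial_derive m n f x y
    = k * (partial_derive (S (S m)) n u x y + partial_derive m (S (S n)) u x y).
Proof.
  intros HM Hu Hf x y Hxy.
  rewrite (partial_derive_ext a b c d f _ m n Hf) by exact Hxy.
  assert (Hxx : unif_smooth (m + n) (rect a b c d) (dx (dx u))).
  { apply (unif_smooth_partial 2 0).
    apply unif_smooth_le with M; auto. lia. }
  assert (Hyy : unif_smooth (m + n) (rect a b c d) (dy (dy u))).
  { apply (unif_smooth_partial 0 2).
    apply unif_smooth_le with M; auto. lia. }
  rewrite (partial_derive_lin a b c d _ _ k m n Hxx Hyy) by exact Hxy.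
  rewrite !partial_derive_dy.
  rewrite (partial_derive_dx a b c d); auto.
  2:{ apply (unif_smooth_partial 1 0).
      apply unif_smooth_le with M; auto. lia. }
  rewrite (partial_derive_dx a b c d); auto.
  apply unif_smooth_le with M; auto. lia.
Qed.

Lemma extension_poisson a b c d u f k M m n : a < b -> c < d ->
  (m + n + 2 <= M)%nat ->
  unif_smooth M (rect a b c d) u ->
  (forall x y, rect a b c d x y -> f x y = k * (dx (dx u) x y + dy (dy u) x y)) ->
  forall x y, closed_rect a b c d x y ->
    extension (rect a b c d) (partial_derive m n f) x y
    = k * (extension (rect a b c d) (partial_derive (S (S m)) n u) x y
           + extension (rect a b c d) (partial_derive m (S (S n)) u) x y).
Proof.
  intros Hab Hcd HM Hu Hf x y Hxy.
  assert (Ha := rect_adherent a b c d x y Hab Hcd Hxy).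
  apply extension_eq; auto.
  apply tends_to_ext with (fun x y => k * (partial_derive (S (S m)) n u x y
                                           + partial_derive m (S (S n)) u x y)).
  { intros. symmetry. now apply (partial_derive_poisson a b c d u f k M m n). }
  apply tends_to_scal, tends_to_plus; apply extension_limit; auto;
    apply (unif_smooth_continuous 0); apply unif_smooth_partial;
    apply unif_smooth_le with M; auto; lia.
Qed.

(* The mean value theorem at x <> x0 bounds the difference quotient uniformly in x,
   because dy v is uniformly continuous; then x tends to x0. *)
Lemma extension_derive_y a b c d v x0 y : a < b -> a <= x0 <= b -> c < y < d ->
  unif_smooth 1 (rect a b c d) v ->
  is_derive (fun t => extension (rect a b c d) v x0 t) y
    (extension (rect a b c d) (dy v) x0 y).
Proof.
  intros Hab Hx Hy Hv.
  assert (Hcd : c < d) by lra.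
  set (D := rect a b c d) in *.
  set (V := fun t => extension D v x0 t).
  assert (Hw : unif_continuous D (dy v))
    by (apply (unif_smooth_continuous 0), Hv).
  assert (Hlim : forall w t, unif_continuous D w -> c < t < d ->
    is_lim_seq (fun n => w (contract x0 ((a + b) / 2) n) t) (extension D w x0 t)).
  { intros w t Hc Ht. apply (tends_to_seq D w x0 t _ _ (fun _ => t)).
    - apply extension_limit; auto. apply rect_adherent; auto.
      split; lra.
    - intros n. split; auto. apply contract_range; lra.
    - apply contract_lim.
    - apply is_lim_seq_const. }
  apply is_derive_Reals. intros eps Heps.
  destruct (Hw (eps / 2)) as [e [He H1]]; [lra|].
  destruct (interval_locally c d y Hy) as [e' He'].
  exists (mkposreal _ (Rmin_pos _ _ He (cond_pos e'))). simpl.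
  intros h Hh0 Hh.
  assert (Hl := Rmin_l e e'). assert (Hr := Rmin_r e e').
  assert (Hin : forall t, Rabs (t - y) <= Rabs h -> c < t < d).
  { intros t Ht. apply He'. change (Rabs (t - y) < e'). lra. }
  assert (Hyh : c < y + h < d).
  { apply Hin. replace (y + h - y) with h by ring. lra. }
  assert (Hmain : Rabs (V (y + h) - V y - h * extension D (dy v) x0 y)
                  <= eps / 2 * Rabs h).
  { refine (is_lim_seq_le
      (fun n => Rabs (v (contract x0 ((a + b) / 2) n) (y + h)
         - v (contract x0 ((a + b) / 2) n) y
         - h * dy v (contract x0 ((a + b) / 2) n) y))
      (fun _ => eps / 2 * Rabs h) (Finite _) (Finite _) _ _ (is_lim_seq_const _)).
    - intros n. set (X := contract x0 ((a + b) / 2) n).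
      assert (HX : a < X < b) by (apply contract_range; lra).
      assert (Hbox : forall s, Rmin y (y + h) <= s <= Rmax y (y + h) ->
        Rabs (s - y) <= Rabs h).
      { intros s. unfold Rmin, Rmax. destruct (Rle_dec y (y + h)); intros Hs;
          unfold Rabs; repeat destruct Rcase_abs; lra. }
      destruct (MVT_gen (fun t => v X t) y (y + h) (fun t => dy v X t))
        as [s [Hs E]].
      + intros s Hs. apply (is_derive_dy 0 D); auto. split; auto. apply Hin, Hbox. lra.
      + intros s Hs. apply continuity_pt_filterlim.
        apply (ex_derive_continuous (K := R_AbsRing) (V := R_NormedModule)).
        eexists. apply (is_derive_dy 0 D); auto. split; auto.
      + rewrite E. replace (_ - _) with ((dy v X s - dy v X y) * h) by ring.
        rewrite Rabs_mult. apply Rmult_le_compat_r; [apply Rabs_pos|].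
        apply Rlt_le, H1.
        * split; auto.
        * split; auto.
        * rewrite Rminus_diag, Rabs_R0; lra.
        * specialize (Hbox s Hs). lra.
    - apply (is_lim_seq_abs _ (Finite _)).
      apply is_lim_seq_minus'.
      + apply is_lim_seq_minus'; apply Hlim; auto;
          now apply (unif_smooth_continuous 1).
      + apply is_lim_seq_mult'; [apply is_lim_seq_const|now apply Hlim]. }
  fold (V (y + h)) (V y).
  assert (Hh' : 0 < Rabs h) by now apply Rabs_pos_lt.
  replace (_ - _) with ((V (y + h) - V y - h * extension D (dy v) x0 y) / h)
    by (field; exact Hh0).
  unfold Rdiv. rewrite Rabs_mult, Rabs_inv.
  apply Rle_lt_trans with (eps / 2 * Rabs h * / Rabs h).
  - apply Rmult_le_compat_r; auto. apply Rlt_le, Rinv_0_lt_compat, Hh'.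
  - field_simplify; lra.
Qed.

(** [g] and [v] are kept apart because the flux [a x y * dx u x y] agrees with a constant multiple
    of [dx u] only inside the rectangle. *)
Lemma tends_to_at_right a b c d v (g : R -> R) y l : a < b -> c < y < d ->
  tends_to (rect a b c d) v a y l -> (forall x, a < x < b -> g x = v x y) ->
  filterlim g (at_right a) (locally l).
Proof.
  intros Hab Hy H Hg. apply filterlim_locally. intros eps.
  destruct (H eps (cond_pos eps)) as [e [He H1]].
  assert (Hm : 0 < Rmin e (b - a)) by (apply Rmin_pos; lra).
  assert (Hl := Rmin_l e (b - a)). assert (Hr := Rmin_r e (b - a)).
  exists (mkposreal _ Hm). intros x Hx Hax.
  change (Rabs (x - a) < Rmin e (b - a)) in Hx.
  change (Rabs (g x - l) < eps).
  assert (Hxb : a < x < b) by (apply Rabs_def2 in Hx; lra).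
  rewrite Hg by exact Hxb. apply H1.
  - now split.
  - lra.
  - rewrite Rminus_diag, Rabs_R0; lra.
Qed.

Lemma tends_to_at_left a b c d v (g : R -> R) y l : a < b -> c < y < d ->
  tends_to (rect a b c d) v b y l -> (forall x, a < x < b -> g x = v x y) ->
  filterlim g (at_left b) (locally l).
Proof.
  intros Hab Hy H Hg. apply filterlim_locally. intros eps.
  destruct (H eps (cond_pos eps)) as [e [He H1]].
  assert (Hm : 0 < Rmin e (b - a)) by (apply Rmin_pos; lra).
  assert (Hl := Rmin_l e (b - a)). assert (Hr := Rmin_r e (b - a)).
  exists (mkposreal _ Hm). intros x Hx Hax.
  change (Rabs (x - b) < Rmin e (b - a)) in Hx.
  change (Rabs (g x - l) < eps).
  assert (Hxb : a < x < b) by (apply Rabs_def2 in Hx; lra).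
  rewrite Hg by exact Hxb. apply H1.
  - now split.
  - lra.
  - rewrite Rminus_diag, Rabs_R0; lra.
Qed.

Lemma has_jump_eq (g : R -> R) (c j vr vl : R) :
  has_jump g c j -> filterlim g (at_right c) (locally vr) ->
  filterlim g (at_left c) (locally vl) -> j = vr - vl.
Proof.
  intros [wr [wl [Hr [Hl <-]]]] Hr' Hl'. f_equal.
  - apply (filterlim_locally_unique (F := at_right c) g); auto.
  - apply (filterlim_locally_unique (F := at_left c) g); auto.
Qed.

(** [E1] and [E2] are the traces on the interface, from the left and from the right, of successive
    y-derivatives. The weights are 1 and 1 for the jump of u, and a_1 and a_2 for the jump of the
    flux. *)
Lemma Derive_n_diff_edge (E1 E2 : nat -> R -> R) (phi : R -> R) (k1 k2 lo hi : R) N :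
  (forall n y, (n < N)%nat -> lo < y < hi -> is_derive (E1 n) y (E1 (S n) y)) ->
  (forall n y, (n < N)%nat -> lo < y < hi -> is_derive (E2 n) y (E2 (S n) y)) ->
  (forall y, lo < y < hi -> phi y = k2 * E2 O y - k1 * E1 O y) ->
  forall n y, (n <= N)%nat -> lo < y < hi ->
    Derive_n phi n y = k2 * E2 n y - k1 * E1 n y.
Proof.
  intros H1 H2 H. induction n as [|n IH]; intros y Hn Hy; [now apply H|].
  simpl. rewrite (Derive_ext_loc _ (fun y => k2 * E2 n y - k1 * E1 n y)).
  - apply is_derive_unique.
    apply (is_derive_minus (K := R_AbsRing) (V := R_NormedModule));
      apply is_derive_scal; [apply H2|apply H1]; auto; lia.
  - apply (filter_imp (fun t => lo < t < hi)); [|now apply interval_locally].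
    intros t Ht. apply IH; auto. lia.
Qed.

(** * Moments of a stencil *)

(** The Taylor polynomial of degree four of a solution of a_p (u_xx + u_yy) = - f, after
    elimination: [J] holds the derivatives of u, [phi] those of f (not the jump), and [k] is
    1/a_p. *)
Definition poisson_jet (J phi : nat -> nat -> R) (k X Y : R) : R :=
  sum_f_R0 (fun n => J 0%nat n * Gpoly 0 n X Y) 4
  + sum_f_R0 (fun n => J 1%nat n * Gpoly 1 n X Y) 3
  + k * sum_Lambda 2 (fun m n => phi m n * Hpoly m n X Y).

Lemma poisson_jet_expansion (J phi : nat -> nat -> R) (k X Y : R) :
  (forall m n, (m + n <= 2)%nat ->
     J (S (S m)) n = - J m (S (S n)) - k * phi m n) ->
  sum_Lambda 4 (taylor_term J X Y)
  = poisson_jet J phi k X Y.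
Proof.
  intros HJ.
  assert (H20 := HJ 0%nat 0%nat ltac:(lia)).
  assert (H21 := HJ 0%nat 1%nat ltac:(lia)).
  assert (H22 := HJ 0%nat 2%nat ltac:(lia)).
  assert (H30 := HJ 1%nat 0%nat ltac:(lia)).
  assert (H31 := HJ 1%nat 1%nat ltac:(lia)).
  assert (H40 := HJ 2%nat 0%nat ltac:(lia)).
  unfold poisson_jet, sum_Lambda, taylor_term, Gpoly, Hpoly, sum_f.
  cbn -[INR fact pow Rplus Rmult Rdiv Rinv].
  (* [J 4 0] goes first: its elimination creates [J 2 2], which [H22] then removes. *)
  rewrite H40, H31, H30, H22, H21, H20.
  cbn [fact INR pow Nat.add Nat.mul].
  field.
Qed.

(** The factor of the (m, n) derivative of u_2 in the truncation error. In the column k = -1 that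
    derivative enters through the jump conditions: with factor 1 for m = 0, and with a_2/a_1 =
    1/alpha for m = 1, where the flux is what jumps. *)
Definition moment (C : Z -> Z -> R) (alpha w h : R) (m n : nat) : R :=
  / alpha ^ m * Gw C w h m n
  + sum3 (fun l => C 0%Z l * Gpoly m n (w * h) (IZR l * h))
  + sum3 (fun l => C 1%Z l * Gpoly m n (w * h + h) (IZR l * h)).

(** G_{m,n} is homogeneous of degree m + n. This turns the truncation error on a test solution into
    a polynomial in h whose coefficients are the moments at h = 1. *)
Lemma moment_scal C alpha w h m n :
  (m <= 1)%nat -> (n <= 4)%nat -> moment C alpha w h m n = h ^ (m + n) * moment C alpha w 1 m n.
Proof.
  intros Hm Hn. 
  destruct m as [|[|m]]; [| |lia];
  destruct n as [|[|[|[|[|n]]]]]; try lia;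
  unfold moment, Gw, sum3, Gpoly;
  cbn -[pow INR Rplus Rmult Rdiv Rinv fact];
  cbn [fact INR pow Nat.add Nat.mul Nat.sub]; unfold Rdiv;
  (* With the inverse abstracted, [field] does not ask for alpha to be nonzero. *)
  generalize (/ (alpha * 1)); intros g; try field.
Qed.

Lemma r1_pos w : 0 < w < 1 -> 0 < r1 w.
Proof.
  intros H. unfold r1. apply Rmult_lt_0_compat; [apply Rmult_lt_0_compat|].
  - apply pow_lt; lra.
  - lra.
  - assert (H1 : 0 < (1 - w) ^ 2) by (apply pow_lt; lra). nra.
Qed.

(** r2 = 4 w^5 + 4 w^3 (1 - w) + w^3 + (6 w^2 - 5 w + 2), and the quadratic has negative
    discriminant. *)
Lemma r2_pos w : 0 < w < 1 -> 0 < r2 w.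
Proof.
  intros H. unfold r2.
  assert (H1 : 0 < w ^ 3 * (1 - w)) by (apply Rmult_lt_0_compat; [apply pow_lt|]; lra).
  assert (H2 : 0 < w ^ 5) by (apply pow_lt; lra).
  assert (H3 : 0 < w ^ 3) by (apply pow_lt; lra).
  nra.
Qed.

Lemma r3_pos w : 0 < w < 1 -> 0 < r3 w.
Proof.
  intros H. unfold r3.
  replace (_ + 4) with ((1 - w) * (8*w^4 + 8*w^3 + 2*w^2 + 4*w + 4)) by ring.
  apply Rmult_lt_0_compat; [lra|].
  assert (H4 : 0 < w ^ 4) by (apply pow_lt; lra).
  assert (H3 : 0 < w ^ 3) by (apply pow_lt; lra).
  assert (H2 : 0 < w ^ 2) by (apply pow_lt; lra). lra.
Qed.

Lemma beta_pos alpha w : 0 < alpha -> 0 < w < 1 -> 0 < beta alpha w.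
Proof.
  intros Ha Hw. unfold beta.
  assert (H1 := r1_pos w Hw). assert (H2 := r2_pos w Hw).
  assert (H3 := r3_pos w Hw). assert (H4 : 0 < alpha ^ 2) by (apply pow_lt; lra).
  assert (H5 := Rmult_lt_0_compat _ _ H2 H4).
  assert (H6 := Rmult_lt_0_compat _ _ H3 Ha). lra.
Qed.

(** For odd n the moment vanishes because the stencil is symmetric in l while G_{m,n} is odd in y.
    The cases with even n are rational identities whose only denominators are alpha and beta. *)
Lemma stencil_moment alpha w m n : 0 < alpha -> 0 < w < 1 ->
  (m <= 1)%nat -> (m + n <= 4)%nat -> moment (stencil alpha w) alpha w 1 m n = 0.
Proof.
  intros Ha Hw Hm Hn.
  assert (Hb : beta alpha w <> 0) by (apply Rgt_not_eq, beta_pos; auto).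
  destruct m as [|[|m]]; [| |lia];
  destruct n as [|[|[|[|[|n]]]]]; try lia;
  unfold moment, Gw, sum3, Gpoly, stencil;
  cbn -[pow INR Rplus Rmult Rdiv Rinv fact r1 r2 r3 r4 r5 r6 r7 r8 r9 r10 r11 r12 s1 s2 s3 t1 beta];
  cbn [fact INR pow Nat.add Nat.mul Nat.sub];
  revert Hb; unfold beta, r1, r2, r3, r4, r5, r6, r7, r8, r9, r10, r11, r12, s1, s2, s3, t1;
  intros Hb; field; repeat split; auto; lra.
Qed.

Lemma moment_lin C C' lambda alpha w h m n :
  moment (fun k l => C k l - lambda * C' k l) alpha w h m n
  = moment C alpha w h m n - lambda * moment C' alpha w h m n.
Proof. unfold moment, Gw, sum3. ring. Qed.

(* The case (m, n) = (0, 4) is the one matched by [O, _]; the last branch is void. *)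
Lemma moment_explicit C alpha w m n : (m <= 1)%nat -> (m + n <= 4)%nat ->
  let g := / alpha in
  let Xm := w - 1 in let Xp := w + 1 in
  moment C alpha w 1 m n =
  match m, n with
  | O, O => sum3 (fun k => sum3 (C k))
  | O, S O => sum3 (fun k => C k 1%Z - C k (-1)%Z)
  | O, S (S O) =>
      (C (-1)%Z 1%Z + C (-1)%Z (-1)%Z + C 0%Z 1%Z + C 0%Z (-1)%Z
       + C 1%Z 1%Z + C 1%Z (-1)%Z
       - Xm ^ 2 * sum3 (C (-1)%Z) - w ^ 2 * sum3 (C 0%Z)
       - Xp ^ 2 * sum3 (C 1%Z)) / 2
  | O, S (S (S O)) =>
      ((C (-1)%Z 1%Z - C (-1)%Z (-1)%Z) * (1 - 3 * Xm ^ 2)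
       + (C 0%Z 1%Z - C 0%Z (-1)%Z) * (1 - 3 * w ^ 2)
       + (C 1%Z 1%Z - C 1%Z (-1)%Z) * (1 - 3 * Xp ^ 2)) / 6
  | O, _ =>
      ((C (-1)%Z 1%Z + C (-1)%Z (-1)%Z) * (1 - 6 * Xm ^ 2)
       + (C 0%Z 1%Z + C 0%Z (-1)%Z) * (1 - 6 * w ^ 2)
       + (C 1%Z 1%Z + C 1%Z (-1)%Z) * (1 - 6 * Xp ^ 2)
       + Xm ^ 4 * sum3 (C (-1)%Z) + w ^ 4 * sum3 (C 0%Z)
       + Xp ^ 4 * sum3 (C 1%Z)) / 24
  | _, O => g * Xm * sum3 (C (-1)%Z) + w * sum3 (C 0%Z) + Xp * sum3 (C 1%Z)
  | _, S O =>
      g * Xm * (C (-1)%Z 1%Z - C (-1)%Z (-1)%Z)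
      + w * (C 0%Z 1%Z - C 0%Z (-1)%Z) + Xp * (C 1%Z 1%Z - C 1%Z (-1)%Z)
  | _, S (S O) =>
      (g * (3 * Xm * (C (-1)%Z 1%Z + C (-1)%Z (-1)%Z) - Xm ^ 3 * sum3 (C (-1)%Z))
      + (3 * w * (C 0%Z 1%Z + C 0%Z (-1)%Z) - w ^ 3 * sum3 (C 0%Z))
      + (3 * Xp * (C 1%Z 1%Z + C 1%Z (-1)%Z) - Xp ^ 3 * sum3 (C 1%Z))) / 6
  | _, _ => moment C alpha w 1 m n
  end.
Proof.
  intros Hm Hn g Xm Xp. unfold Xm, Xp. clear Xm Xp.
  destruct m as [|[|m]]; [| |lia];
  destruct n as [|[|[|[|[|n]]]]]; try lia; try reflexivity;
  unfold moment, Gw, sum3, Gpoly;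
  cbn -[pow INR Rplus Rmult Rdiv Rinv fact];
  cbn [fact INR pow Nat.add Nat.mul Nat.sub]; unfold Rdiv;
  rewrite ?Rmult_1_r, ?Rinv_1; fold g; field.
Qed.

(* The parts of the stencil that are odd and even in l decouple: the odd part solves
   three equations with trivial kernel, and in the even part all unknowns are
   multiples of the total weight pm of the column k = -1. *)
Lemma moments_zero_stencil_zero (E : Z -> Z -> R) alpha w : 0 < alpha -> 0 < w < 1 ->
  (forall m n, (m <= 1)%nat -> (m + n <= 4)%nat -> moment E alpha w 1 m n = 0) ->
  E 0%Z 1%Z + E 0%Z (-1)%Z = 0 ->
  forall k l, (-1 <= k <= 1)%Z -> (-1 <= l <= 1)%Z -> E k l = 0.
Proof.
  intros Ha Hw HE HS0.
  assert (c0 := HE 0%nat 0%nat ltac:(lia) ltac:(lia)).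
  assert (c1 := HE 0%nat 1%nat ltac:(lia) ltac:(lia)).
  assert (c2 := HE 0%nat 2%nat ltac:(lia) ltac:(lia)).
  assert (c3 := HE 0%nat 3%nat ltac:(lia) ltac:(lia)).
  assert (c4 := HE 0%nat 4%nat ltac:(lia) ltac:(lia)).
  assert (d0 := HE 1%nat 0%nat ltac:(lia) ltac:(lia)).
  assert (d1 := HE 1%nat 1%nat ltac:(lia) ltac:(lia)).
  assert (d2 := HE 1%nat 2%nat ltac:(lia) ltac:(lia)).
  clear HE.
  rewrite moment_explicit in c0, c1, c2, c3, c4, d0, d1, d2 by lia.
  cbn iota in *.
  set (pm := sum3 (E (-1)%Z)) in *. set (p0 := sum3 (E 0%Z)) in *.
  set (pp := sum3 (E 1%Z)) in *.
  unfold sum3 in c1.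
  change (pm + p0 + pp = 0) in c0.
  set (am := E (-1)%Z 1%Z - E (-1)%Z (-1)%Z) in *.
  set (a0 := E 0%Z 1%Z - E 0%Z (-1)%Z) in *.
  set (ap := E 1%Z 1%Z - E 1%Z (-1)%Z) in *.
  replace (E (-1)%Z 1%Z + E (-1)%Z (-1)%Z + E 0%Z 1%Z + E 0%Z (-1)%Z
       + E 1%Z 1%Z + E 1%Z (-1)%Z) with
    ((E (-1)%Z 1%Z + E (-1)%Z (-1)%Z) + (E 0%Z 1%Z + E 0%Z (-1)%Z)
       + (E 1%Z 1%Z + E 1%Z (-1)%Z)) in c2 by ring.
  rewrite HS0 in c2, c4, d2.
  set (sm := E (-1)%Z 1%Z + E (-1)%Z (-1)%Z) in *.
  set (sp := E 1%Z 1%Z + E 1%Z (-1)%Z) in *.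
  set (g := / alpha) in *.
  assert (Hg : 0 < g) by (apply Rinv_0_lt_compat; exact Ha).
  assert (Hgw : 0 < g * (1 - w)) by (apply Rmult_lt_0_compat; lra).
  (* Put q = w + g (1 - w). By [c1] and [d1], ap = q am, and [c3] becomes am ((1 - 2w) + (1 + 2w) q)
     = 0. The factor equals 1 - w + 2 w^2 + (1 + 2w) g (1 - w), which is positive. *)
  assert (Ham : am = 0).
  { assert (K : 0 < (1 - 2 * w) + (1 + 2 * w) * (w + g * (1 - w))) by nra.
    apply (Rmult_eq_reg_r ((1 - 2 * w) + (1 + 2 * w) * (w + g * (1 - w)))); [|lra].
    rewrite Rmult_0_l.
    replace (am * _) with
      ((1 + 2 * w) * (w * (am + a0 + ap) - (g * (w - 1) * am + w * a0 + (w + 1) * ap))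
       - 2 * ((am * (1 - 3 * (w - 1) ^ 2) + a0 * (1 - 3 * w ^ 2)
               + ap * (1 - 3 * (w + 1) ^ 2)) / 6)
       + (1 / 3 - w ^ 2) * (am + a0 + ap)) by field.
    rewrite c1, d1, c3. ring. }
  assert (Hap : ap = 0) by (rewrite Ham in *; nra).
  assert (Ha0 : a0 = 0) by lra.
  set (q := w + g * (1 - w)).
  assert (Hpp : pp = pm * q).
  { unfold q. replace p0 with (- pm - pp) in d0 by lra. lra. }
  assert (Hp0 : p0 = - pm * (1 + q)) by lra.
  set (A := (1 - 2 * w) + q * (1 + 2 * w)).
  set (B := g * (w - 1) ^ 3 + q * (w + 1) ^ 3 - (1 + q) * w ^ 3).
  set (D := (w - 1) ^ 4 + q * (w + 1) ^ 4 - (1 + q) * w ^ 4).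
  set (kap := (w + 1) + g * (1 - w)).
  assert (Hk : 0 < kap) by (unfold kap; lra).
  assert (e1 : sm + sp = pm * A).
  { rewrite Hpp, Hp0 in c2. unfold A. lra. }
  assert (e2 : 3 * kap * sp = pm * (B - 3 * g * (w - 1) * A)).
  { rewrite Hpp, Hp0 in d2. unfold B, kap.
    replace sm with (pm * A - sp) in d2 by lra. lra. }
  assert (e3 : (1 - 6 * (w - 1) ^ 2) * sm + (1 - 6 * (w + 1) ^ 2) * sp + pm * D = 0).
  { rewrite Hpp, Hp0 in c4. unfold D. lra. }
  (* In 3 kap [e3] the unknown sm is removed with [e1], which leaves sp with the factor 3 kap (6
     (w-1)^2 - 6 (w+1)^2) = - 72 w kap; adding 24 w times [e2] removes sp. What remains is pm times
     the reduced determinant, here -6 beta g^2. *)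
  assert (Hpm : pm = 0).
  { assert (Hb := beta_pos alpha w Ha Hw).
    assert (Hb' : 0 < beta alpha w * g ^ 2)
      by (apply Rmult_lt_0_compat; auto; apply pow_lt; auto).
    apply (Rmult_eq_reg_r (-6 * (beta alpha w * g ^ 2))); [|lra].
    rewrite Rmult_0_l.
    replace (beta alpha w * g ^ 2) with (r1 w * g ^ 2 + r2 w + r3 w * g)
      by (unfold g, beta; field; lra).
    transitivity (3 * kap * ((1 - 6 * (w - 1) ^ 2) * sm
                             + (1 - 6 * (w + 1) ^ 2) * sp + pm * D)
      - 3 * kap * (1 - 6 * (w - 1) ^ 2) * (sm + sp - pm * A)
      + 24 * w * (3 * kap * sp - pm * (B - 3 * g * (w - 1) * A))).
    - unfold kap, D, A, B, q, r1, r2, r3. ring.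
    - rewrite e3, e1, e2. ring. }
  assert (Hsp : sp = 0).
  { rewrite Hpm, Rmult_0_l in e2.
    apply (Rmult_eq_reg_l (3 * kap)); lra. }
  assert (Hsm : sm = 0) by (rewrite Hpm in e1; lra).
  rewrite Hpm in Hpp, Hp0.
  unfold am, a0, ap, sm, sp, pm, p0, pp, sum3 in *.
  intros k l Hk' Hl.
  assert (Hk1 : (k = -1 \/ k = 0 \/ k = 1)%Z) by lia.
  assert (Hl1 : (l = -1 \/ l = 0 \/ l = 1)%Z) by lia.
  destruct Hk1 as [-> | [-> | ->]]; destruct Hl1 as [-> | [-> | ->]]; lra.
Qed.

Lemma moments_zero_proportional C alpha w : 0 < alpha -> 0 < w < 1 ->
  (forall m n, (m <= 1)%nat -> (m + n <= 4)%nat -> moment C alpha w 1 m n = 0) ->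
  proportional C (stencil alpha w).
Proof.
  intros Ha Hw HC.
  (* The stencil has the entries -1 at (0, 1) and (0, -1), so this lambda makes the sum of these two
     entries of C - lambda stencil vanish, the normalization under which the kernel is trivial. *)
  set (lambda := - (C 0%Z 1%Z + C 0%Z (-1)%Z) / 2).
  exists lambda. intros k l Hk Hl. apply Rminus_diag_uniq.
  apply (moments_zero_stencil_zero (fun k l => C k l - lambda * stencil alpha w k l) alpha w);
    auto.
  - intros m n Hm Hn. rewrite moment_lin, HC, stencil_moment by assumption. ring.
  - unfold lambda. simpl. field.
Qed.

(** * Expansion of the truncation error *)

Lemma extension_ext a b c d v v' x y : a < b -> c < d -> closed_rect a b c d x y ->
  (forall x y, rect a b c d x y -> v x y = v' x y) ->
  unif_continuous (rect a b c d) v ->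
  extension (rect a b c d) v x y = extension (rect a b c d) v' x y.
Proof.
  intros Hab Hcd Hxy He Hv.
  assert (Ha := rect_adherent a b c d x y Hab Hcd Hxy).
  symmetry. apply extension_eq; auto.
  apply tends_to_ext with v; auto. now apply extension_limit.
Qed.

(** Here an outermost [dy] has to be moved inwards past the m derivatives in x. *)
Lemma dy_partial_derive a b c d u m n :
  unif_smooth (m + n + 1) (rect a b c d) u ->
  forall x y, rect a b c d x y ->
    dy (partial_derive m n u) x y = partial_derive m (S n) u x y.
Proof.
  intros Hu. induction m as [|m IH]; [reflexivity|].
  intros x y Hxy.
  transitivity (dx (dy (partial_derive m n u)) x y).
  - symmetry. apply (dx_dy_comm a b c d); auto.
    apply unif_smooth_partial.
    now replace (m + n + 2)%nat with (S m + n + 1)%nat by lia.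
  - apply (dx_ext a b c d (dy (partial_derive m n u)) (partial_derive m (S n) u)); auto.
    apply IH. now apply unif_smooth_S.
Qed.

(** This is what permits differentiating the jump conditions along the interface. *)
Lemma extension_partial_derive_y a b c d u m n x0 y :
  a < b -> a <= x0 <= b -> c < y < d ->
  unif_smooth (m + n + 1) (rect a b c d) u ->
  is_derive (fun t => extension (rect a b c d) (partial_derive m n u) x0 t) y
    (extension (rect a b c d) (partial_derive m (S n) u) x0 y).
Proof.
  intros Hab Hx Hy Hu.
  assert (H1 := unif_smooth_partial m n 1 _ u Hu).
  rewrite <- (extension_ext a b c d (dy (partial_derive m n u))); auto.
  - now apply extension_derive_y.
  - lra.
  - split; lra.
  - now apply dy_partial_derive.
  - apply (unif_smooth_continuous 0), H1.
Qed.

Lemma extension_poisson_jet a b c d u f k x0 y0 L :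
  a < b -> c < d -> 0 < k -> 0 <= L ->
  unif_smooth 4 (rect a b c d) u ->
  (forall m n, (m + n)%nat = 4%nat ->
    forall x y x' y', rect a b c d x y -> rect a b c d x' y' ->
      Rabs (partial_derive m n u x y - partial_derive m n u x' y')
        <= L * (Rabs (x - x') + Rabs (y - y'))) ->
  (forall x y, rect a b c d x y -> f x y = - k * (dx (dx u) x y + dy (dy u) x y)) ->
  closed_rect a b c d x0 y0 ->
  forall r X Y, closed_rect a b c d (x0 + X) (y0 + Y) ->
  Rabs X <= r -> Rabs Y <= r ->
  Rabs (extension (rect a b c d) u (x0 + X) (y0 + Y)
    - poisson_jet (fun m n => extension (rect a b c d) (partial_derive m n u) x0 y0)
        (fun m n => extension (rect a b c d) (partial_derive m n f) x0 y0) (/ k) X Y)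
    <= 6 * L * r ^ 5.
Proof.
  intros Hab Hcd Hk HL Hu HLip Hf H0 r X Y H1 HX HY.
  rewrite <- poisson_jet_expansion.
  - replace 6 with (INR 4 + 2) by (simpl; ring).
    assert (T := extension_taylor a b c d u 4 L r x0 y0 (x0 + X) (y0 + Y)
                   HL Hab Hcd Hu HLip H0 H1).
    replace (x0 + X - x0) with X in T by ring.
    replace (y0 + Y - y0) with Y in T by ring. now apply T.
  - intros m n Hmn.
    rewrite (extension_poisson a b c d u f (- k) 4 m n) by (auto; lia).
    field. lra.
Qed.

(** The terms in f cancel exactly. Solving the jump relations for [J1] gives [J2] minus data, and
    the data produce exactly the two sums with [Gw] in F, so that only [J2] weighted by moments
    remains. The identity holds for an arbitrary stencil, which the uniqueness part relies on. *)
Lemma rhs_poisson_jets (C : Z -> Z -> R) (a1 a2 w h : R)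
    (J1 J2 F1 F2 : nat -> nat -> R) (phi psi : nat -> R) : 0 < a1 -> 0 < a2 ->
  (forall n, (n <= 4)%nat -> phi n = 1 * J2 0%nat n - 1 * J1 0%nat n) ->
  (forall n, (n <= 3)%nat -> psi n = a2 * J2 1%nat n - a1 * J1 1%nat n) ->
  sum3 (fun l => C (-1)%Z l * poisson_jet J1 F1 (/ a1) (w * h - h) (IZR l * h))
  + sum3 (fun l => C 0%Z l * poisson_jet J2 F2 (/ a2) (w * h) (IZR l * h))
  + sum3 (fun l => C 1%Z l * poisson_jet J2 F2 (/ a2) (w * h + h) (IZR l * h))
  - (/ a1 * sum_Lambda 2 (fun m n => F1 m n * Hminus C w h m n)
     + / a2 * sum_Lambda 2 (fun m n => F2 m n * Hplus C w h m n)
     - sum_f_R0 (fun n => phi n * Gw C w h 0 n) 4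
     - / a1 * sum_f_R0 (fun n => psi n * Gw C w h 1 n) 3)
  = sum_f_R0 (fun n => J2 0%nat n * moment C (a1 / a2) w h 0 n) 4
    + sum_f_R0 (fun n => J2 1%nat n * moment C (a1 / a2) w h 1 n) 3.
Proof.
  intros Ha1 Ha2 Hphi Hpsi.
  assert (P0 := Hphi 0%nat ltac:(lia)). assert (P1 := Hphi 1%nat ltac:(lia)).
  assert (P2 := Hphi 2%nat ltac:(lia)). assert (P3 := Hphi 3%nat ltac:(lia)).
  assert (P4 := Hphi 4%nat ltac:(lia)).
  assert (Q0 := Hpsi 0%nat ltac:(lia)). assert (Q1 := Hpsi 1%nat ltac:(lia)).
  assert (Q2 := Hpsi 2%nat ltac:(lia)). assert (Q3 := Hpsi 3%nat ltac:(lia)).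
  unfold poisson_jet, moment, Gw, Hminus, Hplus, sum_Lambda, sum3.
  cbn -[Gpoly Hpoly Rplus Rmult Rdiv Rinv Rminus].
  rewrite P0, P1, P2, P3, P4, Q0, Q1, Q2, Q3.
  field. lra.
Qed.

Lemma coefficient_pos G a ap p : coefficient G a ap -> 0 < ap p.
Proof. intros H. apply H. Qed.

Section Expansion.

Variables (G : geometry) (a f : R -> R -> R) (ap : index -> R)
  (phi psi : index -> R -> R) (g u : R -> R -> R).
Hypothesis Ha : coefficient G a ap.
Hypothesis Hsol : exact_solution G a f phi psi g u.
Hypothesis Hreg : regular_data G f phi psi u.

Lemma poisson_on_rect p b c d e :
  (forall x y, rect b c d e x y -> Omega_ G p x y) ->
  (forall x y, rect b c d e x y -> Omega G x y /\ ~ Gamma G x y) ->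
  forall x y, rect b c d e x y ->
    f x y = - ap p * (dx (dx u) x y + dy (dy u) x y).
Proof.
  intros Hp Hin x y Hxy.
  destruct (Hin x y Hxy) as [H1 H2].
  destruct (pde _ _ _ _ _ _ _ Hsol x y H1 H2) as [_ [_ [_ [_ <-]]]].
  assert (Hap : forall x y, rect b c d e x y -> a x y = ap p)
    by (intros; now apply Ha, Hp).
  destruct Hxy as [Hx Hy].
  rewrite (Derive_ext_loc (fun t => a t y * dx u t y) (fun t => ap p * dx u t y)).
  2:{ apply (filter_imp (fun t => b < t < c)); [|now apply interval_locally].
      intros t Ht. now rewrite Hap by now split. }
  rewrite (Derive_ext_loc (fun t => a x t * dy u x t) (fun t => ap p * dy u x t)).
  2:{ apply (filter_imp (fun t => d < t < e)); [|now apply interval_locally].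
      intros t Ht. now rewrite Hap by now split. }
  rewrite (Derive_scal (fun t => dx u t y)), (Derive_scal (fun t => dy u x t)).
  change (dx (dx u) x y) with (Derive (fun t => dx u t y) x).
  change (dy (dy u) x y) with (Derive (fun t => dy u x t) y). ring.
Qed.

(** Convertible to [Omega_ G I1], as [D2] is to [Omega_ G I2]: the lemmas on rectangles apply to the
    regularity data and to [Lh] without rewriting. *)
Let D1 := rect (l1 G) (xi G) (zeta G) (l4 G).
Let D2 := rect (xi G) (l2 G) (zeta G) (l4 G).

Lemma poisson_D1 x y : D1 x y -> f x y = - ap I1 * (dx (dx u) x y + dy (dy u) x y).
Proof.
  apply (poisson_on_rect I1); [auto|].
  intros s t [Hs Ht]. assert (Hxi := xi_inside G). assert (Hz := zeta_inside G).
  split.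
  - split; lra.
  - intros [[[ | | | ] Hq]|Hq]; simpl in Hq; lra.
Qed.

Lemma poisson_D2 x y : D2 x y -> f x y = - ap I2 * (dx (dx u) x y + dy (dy u) x y).
Proof.
  apply (poisson_on_rect I2); [auto|].
  intros s t [Hs Ht]. assert (Hxi := xi_inside G). assert (Hz := zeta_inside G).
  split.
  - split; lra.
  - intros [[[ | | | ] Hq]|Hq]; simpl in Hq; lra.
Qed.

Lemma smooth_D1 : unif_smooth 4 D1 u.
Proof. exact (u_regular _ _ _ _ _ Hreg I1 (or_introl eq_refl)). Qed.

Lemma smooth_D2 : unif_smooth 4 D2 u.
Proof. exact (u_regular _ _ _ _ _ Hreg I2 (or_intror eq_refl)). Qed.

Let J1 y m n := extension D1 (partial_derive m n u) (xi G) y.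
Let J2 y m n := extension D2 (partial_derive m n u) (xi G) y.

Lemma jet_tends_D1 m n y : (m + n <= 4)%nat -> zeta G < y < l4 G ->
  tends_to D1 (partial_derive m n u) (xi G) y (J1 y m n).
Proof.
  intros Hmn Hy. assert (Hxi := xi_inside G). apply extension_limit.
  - apply rect_adherent; try split; lra.
  - apply (unif_smooth_continuous 0), unif_smooth_partial,
      unif_smooth_le with (2 := smooth_D1). lia.
Qed.

Lemma jet_tends_D2 m n y : (m + n <= 4)%nat -> zeta G < y < l4 G ->
  tends_to D2 (partial_derive m n u) (xi G) y (J2 y m n).
Proof.
  intros Hmn Hy. assert (Hxi := xi_inside G). apply extension_limit.
  - apply rect_adherent; try split; lra.
  - apply (unif_smooth_continuous 0), unif_smooth_partial,
      unif_smooth_le with (2 := smooth_D2). lia.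
Qed.

Lemma phi_jets n y : (n <= 4)%nat -> zeta G < y < l4 G ->
  Derive_n (phi I1) n y = 1 * J2 y 0%nat n - 1 * J1 y 0%nat n.
Proof.
  intros Hn Hy. assert (Hxi := xi_inside G).
  apply (Derive_n_diff_edge (fun n t => J1 t 0%nat n) (fun n t => J2 t 0%nat n)
           _ 1 1 (zeta G) (l4 G) 4); auto.
  - intros k t Hk Ht. apply extension_partial_derive_y; auto; try lra.
    apply unif_smooth_le with (2 := smooth_D1). lia.
  - intros k t Hk Ht. apply extension_partial_derive_y; auto; try lra.
    apply unif_smooth_le with (2 := smooth_D2). lia.
  - intros t Ht. rewrite !Rmult_1_l.
    destruct (jump_vertical _ _ _ _ _ _ _ Hsol I1 t (or_introl eq_refl)
                (conj eq_refl Ht)) as [Hj _].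
    apply (has_jump_eq _ _ _ _ _ Hj).
    + apply (tends_to_at_right (xi G) (l2 G) (zeta G) (l4 G) u _ t); auto; try lra.
      apply (jet_tends_D2 0 0); auto; lia.
    + apply (tends_to_at_left (l1 G) (xi G) (zeta G) (l4 G) u _ t); auto; try lra.
      apply (jet_tends_D1 0 0); auto; lia.
Qed.

Lemma psi_jets n y : (n <= 3)%nat -> zeta G < y < l4 G ->
  Derive_n (psi I1) n y = ap I2 * J2 y 1%nat n - ap I1 * J1 y 1%nat n.
Proof.
  intros Hn Hy. assert (Hxi := xi_inside G).
  apply (Derive_n_diff_edge (fun n t => J1 t 1%nat n) (fun n t => J2 t 1%nat n)
           _ (ap I1) (ap I2) (zeta G) (l4 G) 3); auto.
  - intros k t Hk Ht. apply extension_partial_derive_y; auto; try lra.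
    apply unif_smooth_le with (2 := smooth_D1). lia.
  - intros k t Hk Ht. apply extension_partial_derive_y; auto; try lra.
    apply unif_smooth_le with (2 := smooth_D2). lia.
  - intros t Ht.
    destruct (jump_vertical _ _ _ _ _ _ _ Hsol I1 t (or_introl eq_refl)
                (conj eq_refl Ht)) as [_ Hj].
    apply (has_jump_eq _ _ _ _ _ Hj).
    + apply (tends_to_at_right (xi G) (l2 G) (zeta G) (l4 G)
               (fun x y => ap I2 * dx u x y) _ t); auto; try lra.
      * apply tends_to_scal. apply (jet_tends_D2 1 0); auto; lia.
      * intros x Hx. now rewrite (proj2 (Ha I2) x t (conj Hx Ht)).
    + apply (tends_to_at_left (l1 G) (xi G) (zeta G) (l4 G)
               (fun x y => ap I1 * dx u x y) _ t); auto; try lra.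
      * apply tends_to_scal. apply (jet_tends_D1 1 0); auto; lia.
      * intros x Hx. now rewrite (proj2 (Ha I1) x t (conj Hx Ht)).
Qed.

(** K is chosen before h, x and y: the Lipschitz constants hold on the whole subdomains, hence the
    bound is uniform in the grid point. *)
Lemma truncation_expansion C w : 0 < w < 1 ->
  exists K, forall h x y, 0 < h -> stencil_point G w h x y ->
    zeta G < y < l4 G /\
    Rabs (Lh G C u h x y
          - rhs G C (ap I1) (ap I2) f (phi I1) (psi I1) w h x y
          - (sum_f_R0 (fun n => J2 y 0%nat n * moment C (ap I1 / ap I2) w h 0 n) 4
             + sum_f_R0 (fun n => J2 y 1%nat n * moment C (ap I1 / ap I2) w h 1 n) 3))
      <= K * h ^ 5.
Proof.
  intros Hw. assert (Hxi := xi_inside G).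
  assert (Ha1 := coefficient_pos _ _ _ I1 Ha).
  assert (Ha2 := coefficient_pos _ _ _ I2 Ha).
  destruct (lipschitz_derivatives_nonneg _ _ _ (u_top_lipschitz _ _ _ _ _ Hreg I1
              (or_introl eq_refl))) as [L1 [HL1 HLip1]].
  destruct (lipschitz_derivatives_nonneg _ _ _ (u_top_lipschitz _ _ _ _ _ Hreg I2
              (or_intror eq_refl))) as [L2 [HL2 HLip2]].
  set (N := sum3 (fun k => sum3 (fun l => Rabs (C k l)))).
  (* Here 6 = M + 2 for M = 4 in the Taylor bound, and 32 = 2^5 because the nodes are within 2h of
     the base point: the farthest column is at distance w h + h. *)
  exists (N * (6 * (L1 + L2) * 32)).
  intros h x y Hh [Hbox [[Ex Hy] Hcross]].
  split; [exact Hy|].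
  assert (Hwh : 0 < w * h < h) by (split; nra).
  (* Since |xi - x| = w h < h, excluding the cross point from the square forces |zeta - y| >= h.
     Hence all nine nodes stay in the closures of the two upper subdomains. *)
  assert (Hyz : zeta G + h <= y).
  { destruct (Rle_or_lt (zeta G + h) y) as [?|Hlt]; auto.
    exfalso. apply Hcross. split; apply Rabs_def1; lra. }
  assert (Hl : forall l, (-1 <= l <= 1)%Z -> - h <= IZR l * h <= h).
  { intros l Hlz. assert (E : (l = -1 \/ l = 0 \/ l = 1)%Z) by lia.
    destruct E as [-> | [-> | ->]]; lra. }
  pose (F1 := fun m n => extension D1 (partial_derive m n f) (xi G) y).
  pose (F2 := fun m n => extension D2 (partial_derive m n f) (xi G) y).
  pose (S1 := poisson_jet (J1 y) F1 (/ ap I1)).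
  pose (S2 := poisson_jet (J2 y) F2 (/ ap I2)).
  set (eps := 6 * (L1 + L2) * (2 * h) ^ 5).
  assert (Hpow : 0 < (2 * h) ^ 5) by (apply pow_lt; lra).
  assert (T1 : forall X l, (-1 <= l <= 1)%Z -> X = w * h - h ->
    Rabs (extension D1 u (xi G + X) (y + IZR l * h) - S1 X (IZR l * h)) <= eps).
  { intros X l Hlz ->. specialize (Hl l Hlz).
    apply Rle_trans with (6 * L1 * (2 * h) ^ 5); [|unfold eps; nra].
    apply extension_poisson_jet; auto; try apply smooth_D1; try apply poisson_D1;
      try (split; lra); try lra; apply Rabs_le; lra. }
  assert (T2 : forall X l, (-1 <= l <= 1)%Z -> X = w * h \/ X = w * h + h ->
    Rabs (extension D2 u (xi G + X) (y + IZR l * h) - S2 X (IZR l * h)) <= eps).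
  { intros X l Hlz HX. specialize (Hl l Hlz).
    apply Rle_trans with (6 * L2 * (2 * h) ^ 5); [|unfold eps; nra].
    apply extension_poisson_jet; auto; try apply smooth_D2; try apply poisson_D2;
      try (split; lra); try lra; apply Rabs_le; destruct HX; lra. }
  rewrite <- (rhs_poisson_jets C (ap I1) (ap I2) w h (J1 y) (J2 y) F1 F2
     (fun n => Derive_n (phi I1) n y) (fun n => Derive_n (psi I1) n y));
    auto; try (intros; now apply phi_jets); try (intros; now apply psi_jets).
  fold S1 S2.
  set (R := / ap I1 * sum_Lambda 2 (fun m n => F1 m n * Hminus C w h m n) + _ - _ - _).
  assert (HR : rhs G C (ap I1) (ap I2) f (phi I1) (psi I1) w h x y = R).
  { unfold rhs, R, F1, F2. rewrite Ex. reflexivity. }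
  rewrite HR. clearbody R.
  replace (_ - _ - _) with
    (sum3 (fun l => C (-1)%Z l * (extension D1 u (xi G + (w * h - h)) (y + IZR l * h)
                                  - S1 (w * h - h) (IZR l * h)))
     + sum3 (fun l => C 0%Z l * (extension D2 u (xi G + w * h) (y + IZR l * h)
                                  - S2 (w * h) (IZR l * h)))
     + sum3 (fun l => C 1%Z l * (extension D2 u (xi G + (w * h + h)) (y + IZR l * h)
                                  - S2 (w * h + h) (IZR l * h)))).
  2:{ unfold Lh.
      change (extension (Omega_ G I1)) with (extension D1).
      change (extension (Omega_ G I2)) with (extension D2).
      replace (xi G + (w * h - h)) with (x - h) by lra.
      replace (xi G + w * h) with x by lra.
      replace (xi G + (w * h + h)) with (x + h) by lra.
      unfold sum3. ring. }
  assert (Hterm : forall k l v, Rabs v <= eps -> Rabs (C k l * v) <= Rabs (C k l) * eps).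
  { intros k l v Hv. rewrite Rabs_mult. apply Rmult_le_compat_l; auto. apply Rabs_pos. }
  assert (Hsum : forall s t, (forall l, (-1 <= l <= 1)%Z -> Rabs (s l) <= t l) ->
    Rabs (sum3 s) <= sum3 t).
  { intros s t Hst. unfold sum3.
    assert (A1 := Hst (-1)%Z ltac:(lia)). assert (A2 := Hst 0%Z ltac:(lia)).
    assert (A3 := Hst 1%Z ltac:(lia)).
    assert (A4 := Rabs_triang (s (-1)%Z + s 0%Z) (s 1%Z)).
    assert (A5 := Rabs_triang (s (-1)%Z) (s 0%Z)). lra. }
  replace (N * (6 * (L1 + L2) * 32) * h ^ 5) with
    (sum3 (fun l => Rabs (C (-1)%Z l) * eps) + sum3 (fun l => Rabs (C 0%Z l) * eps)
     + sum3 (fun l => Rabs (C 1%Z l) * eps))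
    by (unfold N, eps, sum3; ring).
  eapply Rle_trans; [apply Rabs_triang|]. apply Rplus_le_compat.
  - eapply Rle_trans; [apply Rabs_triang|]. apply Rplus_le_compat.
    + apply Hsum. intros l Hlz. apply Hterm, T1; auto.
    + apply Hsum. intros l Hlz. apply Hterm, T2; auto.
  - apply Hsum. intros l Hlz. apply Hterm, T2; auto.
Qed.

End Expansion.

(** * Exponential test solutions *)

(** The derivative in x sends (A, B) to (B, -A) and the one in y fixes it. The family is thus closed
    under differentiation, and bounds for all orders follow from those for the functions
    themselves. *)
Definition wave (A B x0 x y : R) : R :=
  exp y * (A * cos (x - x0) + B * sin (x - x0)).

Lemma is_derive_wave_x A B x0 x y :
  is_derive (fun t => wave A B x0 t y) x (wave B (- A) x0 x y).
Proof. unfold wave. auto_derive; auto. unfold Rminus. ring. Qed.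

Lemma is_derive_wave_y A B x0 x y :
  is_derive (fun t => wave A B x0 x t) y (wave A B x0 x y).
Proof. unfold wave. auto_derive; auto. unfold Rminus. ring. Qed.

Lemma wave_at A B x0 y : wave A B x0 x0 y = A * exp y.
Proof. unfold wave. rewrite Rminus_diag, cos_0, sin_0. ring. Qed.

Lemma wave_bound A B x0 x y d : y <= d -> Rabs (wave A B x0 x y) <= exp d * (Rabs A + Rabs B).
Proof.
  intros Hy. unfold wave. rewrite Rabs_mult, (Rabs_pos_eq (exp y)) by apply Rlt_le, exp_pos.
  apply Rmult_le_compat; try apply Rabs_pos; try apply Rlt_le, exp_pos.
  - destruct Hy as [Hy | ->]; [now apply Rlt_le, exp_increasing|apply Rle_refl].
  - eapply Rle_trans; [apply Rabs_triang|]. rewrite !Rabs_mult.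
    assert (Hc : Rabs (cos (x - x0)) <= 1) by apply Rabs_le, COS_bound.
    assert (Hs : Rabs (sin (x - x0)) <= 1) by apply Rabs_le, SIN_bound.
    assert (HA := Rabs_pos A). assert (HB := Rabs_pos B). nra.
Qed.

Lemma derive_bound_lipschitz (g dg : R -> R) K s t :
  (forall z, is_derive g z (dg z)) ->
  (forall z, Rmin s t <= z <= Rmax s t -> Rabs (dg z) <= K) ->
  Rabs (g t - g s) <= K * Rabs (t - s).
Proof.
  intros Hd HK.
  destruct (MVT_gen g s t dg) as [z [Hz E]].
  - intros; apply Hd.
  - intros z Hz. apply continuity_pt_filterlim.
    apply (ex_derive_continuous (K := R_AbsRing) (V := R_NormedModule)).
    eexists; apply Hd.
  - rewrite E, Rabs_mult. apply Rmult_le_compat_r; [apply Rabs_pos|auto].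
Qed.

Lemma wave_lipschitz A B x0 d x y x' y' : y < d -> y' < d ->
  Rabs (wave A B x0 x y - wave A B x0 x' y')
    <= exp d * (Rabs A + Rabs B) * (Rabs (x - x') + Rabs (y - y')).
Proof.
  intros Hy Hy'.
  replace (_ - _) with ((wave A B x0 x y - wave A B x0 x' y)
                        + (wave A B x0 x' y - wave A B x0 x' y')) by ring.
  eapply Rle_trans; [apply Rabs_triang|]. rewrite Rmult_plus_distr_l.
  apply Rplus_le_compat.
  - apply (derive_bound_lipschitz (fun t => wave A B x0 t y) (fun t => wave B (- A) x0 t y)).
    + intros; apply is_derive_wave_x.
    + intros z _. rewrite <- (Rabs_Ropp A), Rplus_comm. apply wave_bound; lra.
  - apply (derive_bound_lipschitz (fun t => wave A B x0 x' t) (fun t => wave A B x0 x' t)).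
    + intros; apply is_derive_wave_y.
    + intros z Hz. apply wave_bound. revert Hz. unfold Rmax. destruct Rle_dec; lra.
Qed.

Lemma wave_unif_continuous A B x0 a b c d :
  unif_continuous (rect a b c d) (wave A B x0).
Proof.
  intros eps Heps. set (K := exp d * (Rabs A + Rabs B)).
  assert (HK : 0 <= K).
  { apply Rmult_le_pos; [apply Rlt_le, exp_pos|].
    apply Rplus_le_le_0_compat; apply Rabs_pos. }
  exists (eps / (2 * (K + 1))). split; [apply Rdiv_lt_0_compat; lra|].
  intros x y x' y' [_ Hy] [_ Hy'] H1 H2.
  eapply Rle_lt_trans; [apply wave_lipschitz with (d := d); lra|]. fold K.
  assert (H3 : (K + 1) * (eps / (2 * (K + 1)) + eps / (2 * (K + 1))) = eps)
    by (field; lra).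
  assert (H4 := Rabs_pos (x - x')). assert (H5 := Rabs_pos (y - y')). nra.
Qed.

Lemma dx_wave A B x0 x y : dx (wave A B x0) x y = wave B (- A) x0 x y.
Proof. apply is_derive_unique, is_derive_wave_x. Qed.

Lemma dy_wave A B x0 x y : dy (wave A B x0) x y = wave A B x0 x y.
Proof. apply is_derive_unique, is_derive_wave_y. Qed.

Lemma wave_unif_smooth M A B x0 a b c d :
  unif_smooth M (rect a b c d) (wave A B x0).
Proof.
  revert A B. induction M as [|M IH]; intros A B.
  - split; auto. apply wave_unif_continuous.
  - split; [apply wave_unif_continuous|]. split; [|split].
    + intros x y _. split; eexists; [apply is_derive_wave_x|apply is_derive_wave_y].
    + apply unif_smooth_ext with (wave B (- A) x0); auto.
      intros; symmetry; apply dx_wave.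
    + apply unif_smooth_ext with (wave A B x0); auto.
      intros; symmetry; apply dy_wave.
Qed.

Lemma partial_derive_wave_y A B x0 n x y :
  partial_derive 0 n (wave A B x0) x y = wave A B x0 x y.
Proof.
  revert y. induction n as [|n IH]; intros y; [reflexivity|].
  change (dy (partial_derive 0 n (wave A B x0)) x y = wave A B x0 x y).
  rewrite <- dy_wave. now apply Derive_ext.
Qed.

Lemma partial_derive_wave_1 A B x0 n x y :
  partial_derive 1 n (wave A B x0) x y = wave B (- A) x0 x y.
Proof.
  rewrite <- dx_wave. apply Derive_ext. intros t. apply partial_derive_wave_y.
Qed.

Lemma partial_derive_wave A B x0 m n : exists A' B',
  forall x y, partial_derive m n (wave A B x0) x y = wave A' B' x0 x y.
Proof.
  induction m as [|m [A' [B' IH]]].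
  - exists A, B. apply partial_derive_wave_y.
  - exists B', (- A'). intros x y. rewrite <- dx_wave.
    apply Derive_ext. intros t. apply IH.
Qed.

Lemma wave_lipschitz_derivatives M A B x0 a b c d :
  lipschitz_derivatives M (rect a b c d) (wave A B x0).
Proof.
  (* [lipschitz_derivatives] wants one constant for all derivatives of order M; the induction on N
     accumulates it over the pairs with m at most N. *)
  assert (H : forall N, exists L, 0 <= L /\ forall m n, (m <= N)%nat -> (m + n)%nat = M ->
    forall x y x' y', rect a b c d x y -> rect a b c d x' y' ->
      Rabs (partial_derive m n (wave A B x0) x y - partial_derive m n (wave A B x0) x' y')
        <= L * (Rabs (x - x') + Rabs (y - y'))).
  { assert (Hone : forall m n, exists L, 0 <= L /\
      forall x y x' y', rect a b c d x y -> rect a b c d x' y' ->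
      Rabs (partial_derive m n (wave A B x0) x y - partial_derive m n (wave A B x0) x' y')
        <= L * (Rabs (x - x') + Rabs (y - y'))).
    { intros m n. destruct (partial_derive_wave A B x0 m n) as [A' [B' E]].
      exists (exp d * (Rabs A' + Rabs B')). split.
      - apply Rmult_le_pos; [apply Rlt_le, exp_pos|].
        apply Rplus_le_le_0_compat; apply Rabs_pos.
      - intros x y x' y' [_ Hy] [_ Hy']. rewrite !E. apply wave_lipschitz; lra. }
    induction N as [|N [L [HL IH]]].
    - destruct (Hone 0%nat M) as [L [HL H]]. exists L. split; auto.
      intros m n Hm Hmn. now replace m with 0%nat by lia; replace n with M by lia.
    - destruct (Hone (S N) (M - S N)%nat) as [L' [HL' H]].
      exists (L + L'). split; [lra|]. intros m n Hm Hmn x y x' y' H1 H2.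
      assert (HR : 0 <= Rabs (x - x') + Rabs (y - y'))
        by (apply Rplus_le_le_0_compat; apply Rabs_pos).
      destruct (Nat.eq_dec m (S N)) as [-> | Hne].
      + replace n with (M - S N)%nat by lia.
        eapply Rle_trans; [now apply H|]. nra.
      + eapply Rle_trans; [apply IH; auto; lia|]. nra. }
  destruct (H M) as [L [_ HL]]. exists L. intros m n Hmn. apply HL; lia.
Qed.

Lemma wave_tends D A B x0 x y :
  tends_to D (wave A B x0) x y (wave A B x0 x y).
Proof.
  intros eps Heps.
  destruct (unif_continuous_pt (x - 1) (x + 1) (y - 1) (y + 1) (wave A B x0) x y
    (wave_unif_continuous _ _ _ _ _ _ _) ltac:(split; lra) (mkposreal eps Heps))
    as [e He].
  exists e. split; [apply cond_pos|]. intros x' y' _. apply He.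
Qed.

Lemma lipschitz_derivatives_ext M a b c d v v' :
  (forall x y, rect a b c d x y -> v x y = v' x y) ->
  lipschitz_derivatives M (rect a b c d) v -> lipschitz_derivatives M (rect a b c d) v'.
Proof.
  intros He [L H]. exists L. intros m n Hmn x y x' y' H1 H2.
  rewrite <- !(partial_derive_ext a b c d v v' m n He) by assumption. now apply H.
Qed.

Lemma Derive_n_scal_exp c k t : Derive_n (fun y => c * exp y) k t = c * exp t.
Proof.
  revert t. induction k as [|k IH]; intros t; [reflexivity|].
  simpl. rewrite (Derive_ext _ _ t IH).
  apply is_derive_unique. auto_derive; auto. ring.
Qed.

Lemma scal_exp_unif_smooth M lo hi c : unif_smooth_1d M lo hi (fun y => c * exp y).
Proof.
  intros k _. split.
  - intros t _. destruct k as [|k]; [exact I|].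
    exists (c * exp t). simpl.
    apply (is_derive_ext (fun y => c * exp y)).
    + intros s. symmetry. apply Derive_n_scal_exp.
    + auto_derive; auto. ring.
  - intros eps.
    assert (HK := exp_pos hi). assert (Hc := Rabs_pos c).
    assert (HK' : 0 <= Rabs c * exp hi) by (apply Rmult_le_pos; lra).
    assert (Hd : 0 < eps / (Rabs c * exp hi + 1))
      by (apply Rdiv_lt_0_compat; [apply cond_pos|lra]).
    exists (mkposreal _ Hd). simpl. intros x y Hx Hy Hxy.
    rewrite !Derive_n_scal_exp.
    apply Rle_lt_trans with (Rabs c * exp hi * Rabs (x - y)).
    + apply (derive_bound_lipschitz (fun y => c * exp y) (fun y => c * exp y)).
      * intros z. auto_derive; auto. ring.
      * intros z Hz. rewrite Rabs_mult. apply Rmult_le_compat_l; auto.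
        rewrite Rabs_pos_eq by apply Rlt_le, exp_pos.
        apply Rlt_le, exp_increasing. revert Hz. unfold Rmax. destruct Rle_dec; lra.
    + assert (E : (Rabs c * exp hi + 1) * (eps / (Rabs c * exp hi + 1)) = eps)
        by (field; lra).
      assert (Hp := Rabs_pos (x - y)). nra.
Qed.

Lemma tends_to_swap a b c d v x y l : tends_to (rect a b c d) v x y l ->
  tends_to (rect c d a b) (fun y x => v x y) y x l.
Proof.
  intros H eps Heps. destruct (H eps Heps) as [e [He H1]].
  exists e. split; auto. intros y' x' [Hy Hx] Hy' Hx'. apply H1; auto. now split.
Qed.

Section TestSolution.

Variables (G : geometry) (a : R -> R -> R) (ap : index -> R) (A B : R).
Hypothesis Ha : coefficient G a ap.

Definition half_wave (x y : R) : R :=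
  if Rlt_dec (xi G) x then wave A B (xi G) x y else 0.

Definition half_wave_phi (p : index) (t : R) : R :=
  match p with I1 | I2 => A * exp t | _ => 0 end.

(** On the vertical branches only the right side contributes, with coefficient a_2 above the cross
    point and a_3 below it. Across the right horizontal branch the function is smooth, but the
    coefficient changes from a_3 to a_2, and the flux jump absorbs this. *)
Definition half_wave_psi (p : index) (t : R) : R :=
  match p with
  | I1 => ap I2 * B * exp t
  | I2 => ap I3 * B * exp t
  | I3 => (ap I2 - ap I3) * wave A B (xi G) t (zeta G)
  | I4 => 0
  end.

Lemma half_wave_right x y : xi G < x -> half_wave x y = wave A B (xi G) x y.
Proof. intros H. unfold half_wave. destruct Rlt_dec; lra. Qed.

(** Zero is written as a wave so that both sides of the line x = xi are handled by the same
    lemmas. *)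
Lemma half_wave_left x y : x <= xi G -> half_wave x y = wave 0 0 (xi G) x y.
Proof. intros H. unfold half_wave, wave. destruct Rlt_dec; lra. Qed.

Lemma half_wave_pde p b c d e A' B' x y :
  (forall x y, rect b c d e x y -> a x y = ap p) ->
  (forall x y, rect b c d e x y -> half_wave x y = wave A' B' (xi G) x y) ->
  rect b c d e x y ->
  ex_derive (fun t => half_wave t y) x /\ ex_derive (fun t => half_wave x t) y /\
  ex_derive (fun t => a t y * dx half_wave t y) x /\
  ex_derive (fun t => a x t * dy half_wave x t) y /\
  - (Derive (fun t => a t y * dx half_wave t y) x
     + Derive (fun t => a x t * dy half_wave x t) y) = 0.
Proof.
  intros Hap Hw Hxy.
  assert (Hs : unif_smooth 2 (rect b c d e) half_wave).
  { apply unif_smooth_ext with (wave A' B' (xi G)).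
    - intros; symmetry; now apply Hw.
    - apply wave_unif_smooth. }
  assert (Hdx : forall x y, rect b c d e x y -> dx half_wave x y = wave B' (- A') (xi G) x y).
  { intros s t Hst. rewrite (dx_ext b c d e _ _ s t Hw Hst). apply dx_wave. }
  assert (Hdy : forall x y, rect b c d e x y -> dy half_wave x y = wave A' B' (xi G) x y).
  { intros s t Hst. rewrite (dy_ext b c d e _ _ s t Hw Hst). apply dy_wave. }
  assert (Hx : is_derive (fun t : R => a t y * dx half_wave t y) x
                 (ap p * wave (- A') (- B') (xi G) x y)).
  { apply (is_derive_ext_loc (fun t => ap p * wave B' (- A') (xi G) t y)).
    - apply (filter_imp (fun t => b < t < c)); [|apply interval_locally, Hxy].
      intros t Ht. rewrite Hap, Hdx; auto; split; auto; apply Hxy.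
    - apply is_derive_scal, is_derive_wave_x. }
  assert (Hy : is_derive (fun t : R => a x t * dy half_wave x t) y
                 (ap p * wave A' B' (xi G) x y)).
  { apply (is_derive_ext_loc (fun t => ap p * wave A' B' (xi G) x t)).
    - apply (filter_imp (fun t => d < t < e)); [|apply interval_locally, Hxy].
      intros t Ht. rewrite Hap, Hdy; auto; split; auto; apply Hxy.
    - apply is_derive_scal, is_derive_wave_y. }
  split; [eexists; now apply (is_derive_dx 1 (rect b c d e))|].
  split; [eexists; now apply (is_derive_dy 1 (rect b c d e))|].
  split; [eexists; exact Hx|]. split; [eexists; exact Hy|].
  rewrite (is_derive_unique _ _ _ Hx), (is_derive_unique _ _ _ Hy).
  unfold wave. ring.
Qed.

Lemma half_wave_right_limits p c d y : c < y < d ->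
  (forall x y, rect (xi G) (l2 G) c d x y -> a x y = ap p) ->
  filterlim (fun x => half_wave x y) (at_right (xi G)) (locally (A * exp y)) /\
  filterlim (fun x => a x y * dx half_wave x y) (at_right (xi G))
    (locally (ap p * B * exp y)).
Proof.
  intros Hy Hap. assert (Hxi := xi_inside G).
  assert (Hw : forall x y, rect (xi G) (l2 G) c d x y -> half_wave x y = wave A B (xi G) x y).
  { intros s t [Hs _]. apply half_wave_right; lra. }
  split.
  - rewrite <- (wave_at A B (xi G)).
    apply (tends_to_at_right _ (l2 G) c d (wave A B (xi G)) _ y); auto; try lra.
    + apply wave_tends.
    + intros x Hx. apply Hw. now split.
  - rewrite Rmult_assoc, <- (wave_at B (- A) (xi G)).
    apply (tends_to_at_right _ (l2 G) c d
             (fun x y => ap p * wave B (- A) (xi G) x y) _ y); auto; try lra.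
    + apply tends_to_scal, wave_tends.
    + intros x Hx. assert (Hr : rect (xi G) (l2 G) c d x y) by now split.
      rewrite Hap by exact Hr. now rewrite (dx_ext _ _ _ _ _ _ x y Hw Hr), dx_wave.
Qed.

Lemma half_wave_left_limits p c d y : c < y < d ->
  (forall x y, rect (l1 G) (xi G) c d x y -> a x y = ap p) ->
  filterlim (fun x => half_wave x y) (at_left (xi G)) (locally 0) /\
  filterlim (fun x => a x y * dx half_wave x y) (at_left (xi G)) (locally 0).
Proof.
  intros Hy Hap. assert (Hxi := xi_inside G).
  assert (Hw : forall x y, rect (l1 G) (xi G) c d x y -> half_wave x y = wave 0 0 (xi G) x y).
  { intros s t [Hs _]. apply half_wave_left; lra. }
  split.
  - replace 0 with (wave 0 0 (xi G) (xi G) y) at 1 by (rewrite wave_at; ring).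
    apply (tends_to_at_left (l1 G) _ c d (wave 0 0 (xi G)) _ y); auto; try lra.
    + apply wave_tends.
    + intros x Hx. apply Hw. now split.
  - replace 0 with (ap p * wave 0 0 (xi G) (xi G) y) at 1 by (rewrite wave_at; ring).
    apply (tends_to_at_left (l1 G) _ c d
             (fun x y => ap p * wave 0 0 (xi G) x y) _ y); auto; try lra.
    + apply tends_to_scal, wave_tends.
    + intros x Hx. assert (Hr : rect (l1 G) (xi G) c d x y) by now split.
      rewrite Hap by exact Hr. rewrite (dx_ext _ _ _ _ _ _ x y Hw Hr), dx_wave.
      now rewrite Ropp_0.
Qed.

Lemma half_wave_horizontal_limits p q b c A' B' x : b < x < c ->
  (forall x y, rect b c (zeta G) (l4 G) x y -> a x y = ap p) ->
  (forall x y, rect b c (l3 G) (zeta G) x y -> a x y = ap q) ->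
  (forall x y, b < x < c -> half_wave x y = wave A' B' (xi G) x y) ->
  has_jump (fun y => half_wave x y) (zeta G) 0 /\
  has_jump (fun y => a x y * dy half_wave x y) (zeta G)
    ((ap p - ap q) * wave A' B' (xi G) x (zeta G)).
Proof.
  intros Hx Hp Hq Hw. assert (Hz := zeta_inside G).
  assert (Hdy : forall y, dy half_wave x y = wave A' B' (xi G) x y).
  { intros y. rewrite <- dy_wave. apply Derive_ext. intros t. now apply Hw. }
  split.
  - exists (wave A' B' (xi G) x (zeta G)), (wave A' B' (xi G) x (zeta G)).
    split; [|split; [|ring]].
    + apply (tends_to_at_right _ (l4 G) b c (fun y x => wave A' B' (xi G) x y) _ x); auto;
        try lra. apply tends_to_swap, wave_tends.
    + apply (tends_to_at_left (l3 G) _ b c (fun y x => wave A' B' (xi G) x y) _ x); auto;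
        try lra. apply tends_to_swap, wave_tends.
  - exists (ap p * wave A' B' (xi G) x (zeta G)), (ap q * wave A' B' (xi G) x (zeta G)).
    split; [|split; [|ring]].
    + apply (tends_to_at_right _ (l4 G) b c
               (fun y x => ap p * wave A' B' (xi G) x y) _ x); auto; try lra.
      * apply (tends_to_scal _ (fun y x => wave A' B' (xi G) x y)).
        apply tends_to_swap, wave_tends.
      * intros y Hy. rewrite Hdy, Hp; [reflexivity|now split].
    + apply (tends_to_at_left (l3 G) _ b c
               (fun y x => ap q * wave A' B' (xi G) x y) _ x); auto; try lra.
      * apply (tends_to_scal _ (fun y x => wave A' B' (xi G) x y)).
        apply tends_to_swap, wave_tends.
      * intros y Hy. rewrite Hdy, Hq; [reflexivity|now split].
Qed.

Lemma half_wave_tends D x y : x <> xi G ->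
  tends_to D half_wave x y (half_wave x y).
Proof.
  intros Hx eps Heps.
  assert (H : exists A' B', forall x' y', Rabs (x' - x) < Rabs (x - xi G) ->
                half_wave x' y' = wave A' B' (xi G) x' y').
  { destruct (Rle_or_lt x (xi G)) as [Hle|Hlt].
    - exists 0, 0. intros x' y' H. apply half_wave_left.
      revert H. unfold Rabs. repeat destruct Rcase_abs; lra.
    - exists A, B. intros x' y' H. apply half_wave_right.
      revert H. unfold Rabs. repeat destruct Rcase_abs; lra. }
  destruct H as [A' [B' H]].
  assert (Hd : 0 < Rabs (x - xi G)) by (apply Rabs_pos_lt; lra).
  destruct (wave_tends D A' B' (xi G) x y eps Heps) as [e [He H1]].
  assert (Hl := Rmin_l e (Rabs (x - xi G))). assert (Hr := Rmin_r e (Rabs (x - xi G))).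
  exists (Rmin e (Rabs (x - xi G))). split; [now apply Rmin_pos|].
  intros x' y' HD Hx' Hy'. rewrite !H.
  - apply H1; auto; lra.
  - rewrite Rminus_diag, Rabs_R0. exact Hd.
  - lra.
Qed.

(** Uniqueness is tested with solutions of the full problem on all four subdomains. The boundary
    data are the function itself, and continuity at the boundary holds because away from x = xi the
    function is locally a wave. *)
Lemma half_wave_solution :
  exact_solution G a (fun _ _ => 0) half_wave_phi half_wave_psi half_wave half_wave.
Proof.
  assert (Hxi := xi_inside G). assert (Hz := zeta_inside G).
  assert (Hap : forall p x y, Omega_ G p x y -> a x y = ap p)
    by (intros; now apply Ha).
  constructor.
  - intros x y [Hx Hy] HG.
    destruct (Rtotal_order y (zeta G)) as [Hyz|[Hyz|Hyz]];
    destruct (Rtotal_order x (xi G)) as [Hxx|[Hxx|Hxx]];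
    (* Of the nine positions relative to the cross, five lie on the interface and are discarded
       here; the four open quadrants remain. *)
    try (exfalso; apply HG; unfold Gamma; subst; auto; left;
         first [exists I1; simpl; lra|exists I2; simpl; lra
               |exists I3; simpl; lra|exists I4; simpl; lra]).
    + apply (half_wave_pde I4 (l1 G) (xi G) (l3 G) (zeta G) 0 0);
        [apply (Hap I4)|intros s t [Hs _]; apply half_wave_left; lra|split; lra].
    + apply (half_wave_pde I3 (xi G) (l2 G) (l3 G) (zeta G) A B);
        [apply (Hap I3)|intros s t [Hs _]; apply half_wave_right; lra|split; lra].
    + apply (half_wave_pde I1 (l1 G) (xi G) (zeta G) (l4 G) 0 0);
        [apply (Hap I1)|intros s t [Hs _]; apply half_wave_left; lra|split; lra].
    + apply (half_wave_pde I2 (xi G) (l2 G) (zeta G) (l4 G) A B);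
        [apply (Hap I2)|intros s t [Hs _]; apply half_wave_right; lra|split; lra].
  - intros p y Hp Hy.
    assert (Hlim : exists q, half_wave_psi p y = ap q * B * exp y /\
      half_wave_phi p y = A * exp y /\
      (filterlim (fun x => half_wave x y) (at_right (xi G)) (locally (A * exp y)) /\
       filterlim (fun x => a x y * dx half_wave x y) (at_right (xi G))
         (locally (ap q * B * exp y))) /\
      (filterlim (fun x => half_wave x y) (at_left (xi G)) (locally 0) /\
       filterlim (fun x => a x y * dx half_wave x y) (at_left (xi G)) (locally 0))).
    { destruct Hp as [-> | ->]; destruct Hy as [_ Hy].
      - exists I2. split; [reflexivity|]. split; [reflexivity|]. split.
        + apply (half_wave_right_limits I2 (zeta G) (l4 G)); [exact Hy|apply (Hap I2)].
        + apply (half_wave_left_limits I1 (zeta G) (l4 G)); [exact Hy|apply (Hap I1)].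
      - exists I3. split; [reflexivity|]. split; [reflexivity|]. split.
        + apply (half_wave_right_limits I3 (l3 G) (zeta G)); [exact Hy|apply (Hap I3)].
        + apply (half_wave_left_limits I4 (l3 G) (zeta G)); [exact Hy|apply (Hap I4)]. }
    destruct Hlim as [q [-> [-> [[R1 R2] [L1 L2]]]]].
    split; [exists (A * exp y), 0|exists (ap q * B * exp y), 0];
      (split; [assumption|split; [assumption|ring]]).
  - intros p x [-> | ->] [Hx _].
    + apply (half_wave_horizontal_limits I2 I3 (xi G) (l2 G) A B);
        [exact Hx|apply (Hap I2)|apply (Hap I3)|].
      intros s t Hs. apply half_wave_right; lra.
    + simpl. replace 0 with ((ap I1 - ap I4) * wave 0 0 (xi G) x (zeta G)) at 2
        by (unfold wave; ring).
      apply (half_wave_horizontal_limits I1 I4 (l1 G) (xi G) 0 0);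
        [exact Hx|apply (Hap I1)|apply (Hap I4)|].
      intros s t Hs. apply half_wave_left; lra.
  - auto.
  - intros x y _ Hx _. apply tends_to_filterlim. now apply half_wave_tends.
Qed.

Lemma half_wave_regular :
  regular_data G (fun _ _ => 0) half_wave_phi half_wave_psi half_wave.
Proof.
  assert (H1 : forall x y, rect (l1 G) (xi G) (zeta G) (l4 G) x y ->
    wave 0 0 (xi G) x y = half_wave x y).
  { intros x y [Hx _]. symmetry. apply half_wave_left; lra. }
  assert (H2 : forall x y, rect (xi G) (l2 G) (zeta G) (l4 G) x y ->
    wave A B (xi G) x y = half_wave x y).
  { intros x y [Hx _]. symmetry. apply half_wave_right; lra. }
  constructor.
  - intros p [-> | ->].
    + apply (unif_smooth_ext _ _ _ _ _ _ _ H1), wave_unif_smooth.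
    + apply (unif_smooth_ext _ _ _ _ _ _ _ H2), wave_unif_smooth.
  - intros p [-> | ->]; apply unif_smooth_ext with (wave 0 0 0);
      try apply wave_unif_smooth; intros; unfold wave; ring.
  - apply scal_exp_unif_smooth.
  - apply scal_exp_unif_smooth.
  - intros p [-> | ->].
    + apply (lipschitz_derivatives_ext _ _ _ _ _ _ _ H1), wave_lipschitz_derivatives.
    + apply (lipschitz_derivatives_ext _ _ _ _ _ _ _ H2), wave_lipschitz_derivatives.
Qed.

Lemma half_wave_jet m n y A' B' : zeta G < y < l4 G ->
  (forall x y, partial_derive m n (wave A B (xi G)) x y = wave A' B' (xi G) x y) ->
  extension (rect (xi G) (l2 G) (zeta G) (l4 G)) (partial_derive m n half_wave) (xi G) y
  = A' * exp y.
Proof.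
  intros Hy E. assert (Hxi := xi_inside G).
  rewrite <- (wave_at A' B' (xi G)).
  apply extension_eq.
  - apply rect_adherent; try split; lra.
  - apply tends_to_ext with (wave A' B' (xi G)); [|apply wave_tends].
    intros s t Hst. rewrite <- E. symmetry.
    apply (partial_derive_ext (xi G) (l2 G) (zeta G) (l4 G)); auto.
    intros x' y' [Hx' _]. apply half_wave_right; lra.
Qed.

End TestSolution.

(** * Consistency and uniqueness *)

(** The lowest coefficient is O(h), hence zero; dividing by h lowers both the degree and the order
    of smallness by one. Arbitrarily small h suffice, so the bound is required only along a set of
    steps accumulating at 0. *)
Lemma poly_small_coeff_zero K N : forall c : nat -> R,
  (forall delta, 0 < delta -> exists h, 0 < h < delta /\
     Rabs (sum_f_R0 (fun n => c n * h ^ n) N) <= K * h ^ S N) ->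
  forall n, (n <= N)%nat -> c n = 0.
Proof.
  assert (Hzero : forall x M, (forall delta, 0 < delta -> exists h, 0 < h < delta /\
             Rabs x <= M * h) -> x = 0).
  { intros x M H. destruct (Req_dec x 0) as [E|E]; auto. exfalso.
    apply Rabs_pos_lt in E.
    destruct (H (Rabs x / (Rabs M + 1))) as [h [[Hh1 Hh2] Hx]].
    { apply Rdiv_lt_0_compat; auto. generalize (Rabs_pos M); lra. }
    assert (HM := Rabs_pos M). assert (HM' := Rle_abs M).
    assert (E2 : (Rabs M + 1) * (Rabs x / (Rabs M + 1)) = Rabs x) by (field; lra).
    nra. }
  induction N as [|N IH]; intros c H n Hn.
  - replace n with 0%nat by lia. apply (Hzero _ K). intros d Hd.
    destruct (H d Hd) as [h [Hh Hb]]. exists h. split; auto.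
    simpl in Hb. now rewrite !Rmult_1_r in Hb.
  - assert (Hsplit : forall h, sum_f_R0 (fun n => c n * h ^ n) (S N)
              = c O + h * sum_f_R0 (fun n => c (S n) * h ^ n) N).
    { intros h. rewrite decomp_sum by lia. rewrite Rmult_1_r, scal_sum. f_equal.
      apply sum_eq. intros i _. simpl. ring. }
    assert (Hc0 : c O = 0).
    { set (M := sum_f_R0 (fun n => Rabs (c (S n))) N).
      apply (Hzero _ (M + Rabs K)). intros d Hd.
      destruct (H (Rmin d 1)) as [h [[Hh1 Hh2] Hb]]; [apply Rmin_pos; lra|].
      assert (Hl := Rmin_l d 1). assert (Hr := Rmin_r d 1).
      exists h. split; [lra|]. rewrite Hsplit in Hb.
      assert (Hpow : forall k, 0 <= h ^ k <= 1).
      { intros k. split; [apply pow_le; lra|].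
        rewrite <- (pow1 k). apply pow_incr. lra. }
      assert (HM : Rabs (sum_f_R0 (fun n => c (S n) * h ^ n) N) <= M).
      { eapply Rle_trans; [apply Rsum_abs|]. apply sum_Rle. intros k _.
        rewrite Rabs_mult, (Rabs_pos_eq (h ^ k)) by apply Hpow.
        generalize (Rabs_pos (c (S k))) (Hpow k). nra. }
      set (T := sum_f_R0 (fun n => c (S n) * h ^ n) N) in *.
      replace (c O) with ((c O + h * T) - h * T) by ring.
      unfold Rminus. eapply Rle_trans; [apply Rabs_triang|].
      rewrite Rabs_Ropp, Rabs_mult, (Rabs_pos_eq h) by lra.
      assert (HK : K * h ^ S (S N) <= Rabs K * h).
      { apply Rle_trans with (Rabs K * h ^ S (S N)).
        - apply Rmult_le_compat_r; [apply Hpow|apply Rle_abs].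
        - apply Rmult_le_compat_l; [apply Rabs_pos|].
          rewrite <- tech_pow_Rmult. generalize (Hpow (S N)). nra. }
      nra. }
    destruct n as [|n]; [exact Hc0|].
    apply (IH (fun n => c (S n))); [|lia].
    intros d Hd. destruct (H d Hd) as [h [[Hh1 Hh2] Hb]]. exists h. split; auto.
    rewrite Hsplit, Hc0, Rplus_0_l, Rabs_mult, (Rabs_pos_eq h) in Hb by lra.
    apply (Rmult_le_reg_l h); auto. eapply Rle_trans; [exact Hb|].
    right. rewrite <- (tech_pow_Rmult h (S N)). ring.
Qed.

(** Consistency bounds the truncation error, and the expansion bounds its distance to the
    combination of moments, both by a multiple of h^5. At the base point every derivative of u_2
    involved is A e^y or B e^y, so the only trace of the moving base point is the factor e^y. *)
Lemma half_wave_moments_small (P : R -> R -> R -> Prop) G a ap w C A B :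
  coefficient G a ap -> 0 < w < 1 ->
  (forall h x y, 0 < h -> P h x y -> stencil_point G w h x y) ->
  arbitrarily_fine P -> consistent 4 P G a ap w C ->
  exists K, forall delta, 0 < delta -> exists h, 0 < h < delta /\
    Rabs (A * sum_f_R0 (fun n => moment C (ap I1 / ap I2) w 1 0 n * h ^ n) 4
          + B * h * sum_f_R0 (fun n => moment C (ap I1 / ap I2) w 1 1 n * h ^ n) 3)
      <= K * h ^ 5.
Proof.
  intros Ha Hw HP Hfine HC.
  assert (Hsol := half_wave_solution G a ap A B Ha).
  assert (Hreg := half_wave_regular G ap A B).
  destruct (HC _ _ _ _ _ Hsol Hreg) as [K1 [d1 [Hd1 H1]]].
  destruct (truncation_expansion G a _ ap _ _ _ _ Ha Hsol Hreg C w Hw) as [K2 H2].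
  (* The base point lies on the branch y > zeta, so that e^y > e^zeta and the common factor can be
     divided out uniformly. *)
  exists ((Rabs K1 + Rabs K2) / exp (zeta G)).
  intros delta Hdelta.
  destruct (Hfine (Rmin delta d1)) as [h [x [y [[Hh1 Hh2] HPh]]]];
    [now apply Rmin_pos|].
  assert (Hl := Rmin_l delta d1). assert (Hr := Rmin_r delta d1).
  exists h. split; [lra|].
  specialize (H1 h x y ltac:(lra) HPh).
  destruct (H2 h x y Hh1 (HP h x y Hh1 HPh)) as [Hy H2']. clear H2.
  set (T := Lh G C _ h x y - _) in *.
  rewrite (sum_eq _ (fun n => moment C (ap I1 / ap I2) w 1 0 n * h ^ n * (A * exp y))) in H2'.
  2:{ intros n Hn.
      rewrite (half_wave_jet G A B 0 n y A B Hy) by apply partial_derive_wave_y.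
      rewrite (moment_scal C _ w h) by lia. simpl Nat.add. ring. }
  rewrite (sum_eq (fun n => _ * moment _ _ _ h 1 n)
             (fun n => moment C (ap I1 / ap I2) w 1 1 n * h ^ n * (h * B * exp y))) in H2'.
  2:{ intros n Hn.
      rewrite (half_wave_jet G A B 1 n y B (- A) Hy) by apply partial_derive_wave_1.
      rewrite (moment_scal C _ w h) by lia. simpl. ring. }
  rewrite <- !scal_sum in H2'.
  set (S0 := sum_f_R0 _ 4) in *. set (S1 := sum_f_R0 _ 3) in *.
  assert (Hp : 0 < h ^ 5) by (apply pow_lt; lra).
  assert (HT : Rabs T <= Rabs K1 * h ^ 5).
  { rewrite Rabs_mult, Rabs_inv, (Rabs_pos_eq h) in H1 by lra.
    apply (Rmult_le_reg_l (/ h)); [apply Rinv_0_lt_compat; lra|].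
    eapply Rle_trans; [exact H1|].
    replace (/ h * (Rabs K1 * h ^ 5)) with (Rabs K1 * h ^ 4) by (field; lra).
    apply Rmult_le_compat_r; [apply pow_le; lra|apply Rle_abs]. }
  assert (HE : Rabs (exp y * (A * S0 + B * h * S1)) <= (Rabs K1 + Rabs K2) * h ^ 5).
  { replace (exp y * (A * S0 + B * h * S1)) with
      (T - (T - (A * exp y * S0 + h * B * exp y * S1))) by ring.
    unfold Rminus at 1. eapply Rle_trans; [apply Rabs_triang|]. rewrite Rabs_Ropp.
    generalize (Rle_abs K2). nra. }
  assert (Hz := exp_pos (zeta G)).
  assert (Hzy : exp (zeta G) < exp y) by (apply exp_increasing; lra).
  rewrite Rabs_mult, (Rabs_pos_eq (exp y)) in HE by lra.
  apply (Rmult_le_reg_l (exp (zeta G))); auto.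
  replace (exp (zeta G) * ((Rabs K1 + Rabs K2) / exp (zeta G) * h ^ 5))
    with ((Rabs K1 + Rabs K2) * h ^ 5) by (field; lra).
  eapply Rle_trans; [|exact HE].
  apply Rmult_le_compat_r; [apply Rabs_pos|lra].
Qed.

Lemma consistent_proportional (P : R -> R -> R -> Prop) G a ap w C :
  coefficient G a ap -> 0 < w < 1 ->
  (forall h x y, 0 < h -> P h x y -> stencil_point G w h x y) ->
  arbitrarily_fine P -> consistent 4 P G a ap w C ->
  proportional C (stencil (ap I1 / ap I2) w).
Proof.
  intros Ha Hw HP Hfine HC.
  assert (Ha1 := coefficient_pos _ _ _ I1 Ha).
  assert (Ha2 := coefficient_pos _ _ _ I2 Ha).
  apply moments_zero_proportional; auto; [now apply Rdiv_lt_0_compat|].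
  intros m n Hm Hmn. destruct m as [|[|m]]; [| |lia].
  - destruct (half_wave_moments_small P G a ap w C 1 0 Ha Hw HP Hfine HC) as [K HK].
    apply (poly_small_coeff_zero K 4 (fun n => moment C (ap I1 / ap I2) w 1 0 n)); auto.
    intros d Hd. destruct (HK d Hd) as [h [Hh Hb]]. exists h. split; auto.
    now rewrite Rmult_1_l, !Rmult_0_l, Rplus_0_r in Hb.
  (* The moments with m = 1 carry an extra factor h; cancelling it leaves a cubic of size O(h^4). *)
  - destruct (half_wave_moments_small P G a ap w C 0 1 Ha Hw HP Hfine HC) as [K HK].
    apply (poly_small_coeff_zero K 3 (fun n => moment C (ap I1 / ap I2) w 1 1 n)); [|lia].
    intros d Hd. destruct (HK d Hd) as [h [[Hh1 Hh2] Hb]]. exists h. split; auto.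
    rewrite Rmult_1_l, Rmult_0_l, Rplus_0_l, Rabs_mult, (Rabs_pos_eq h) in Hb by lra.
    apply (Rmult_le_reg_l h); auto. eapply Rle_trans; [exact Hb|].
    right. ring.
Qed.

Lemma stencil_consistent G a ap w :
  coefficient G a ap -> 0 < w < 1 ->
  consistent 4 (stencil_point G w) G a ap w (stencil (ap I1 / ap I2) w).
Proof.
  intros Ha Hw f phi psi g u Hsol Hreg.
  assert (Ha1 := coefficient_pos _ _ _ I1 Ha).
  assert (Ha2 := coefficient_pos _ _ _ I2 Ha).
  assert (Hal : 0 < ap I1 / ap I2) by now apply Rdiv_lt_0_compat.
  destruct (truncation_expansion G a f ap phi psi g u Ha Hsol Hreg
              (stencil (ap I1 / ap I2) w) w Hw) as [K HK].
  (* The expansion is valid for every h > 0; the threshold 1 is arbitrary. *)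
  exists K, 1. split; [lra|]. intros h x y [Hh _] Hp.
  destruct (HK h x y Hh Hp) as [_ HT].
  rewrite (sum_eq_R0 _ 4), (sum_eq_R0 _ 3), Rplus_0_r, Rminus_0_r in HT.
  - rewrite Rabs_mult, Rabs_inv, (Rabs_pos_eq h) by lra.
    apply (Rmult_le_reg_l h); auto. rewrite <- Rmult_assoc, Rinv_r, Rmult_1_l by lra.
    eapply Rle_trans; [exact HT|]. right. ring.
  - intros n Hn. rewrite moment_scal, stencil_moment by (auto; lia). ring.
  - intros n Hn. rewrite moment_scal, stencil_moment by (auto; lia). ring.
Qed.

Lemma consistent_imp r (P Q : R -> R -> R -> Prop) G a ap w C :
  (forall h x y, 0 < h -> Q h x y -> P h x y) ->
  consistent r P G a ap w C -> consistent r Q G a ap w C.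
Proof.
  intros HQ HP f phi psi g u Hsol Hreg.
  destruct (HP f phi psi g u Hsol Hreg) as [K [d [Hd H]]].
  exists K, d. split; auto. intros h x y Hh HQh. apply H; auto. apply HQ; tauto.
Qed.

(** An interior node has indices at least 1 and at most the number of steps minus 1, so its
    neighbours lie in the closed domain. In the vertical direction the aspect ratio makes N0 N1
    steps of length h fill the height exactly. *)
Lemma mesh_stencil_point G w h x y :
  0 < h -> mesh_point G w h x y -> stencil_point G w h x y.
Proof.
  intros Hh [[N1 [i [j [HN [_ [_ [Eh [Ex Ey]]]]]]]] [[Hx Hy] [_ [HG Hcross]]]].
  split; [|split; assumption].
  assert (HN1 : 0 < INR N1) by (apply lt_0_INR; lia).
  assert (E12 : l2 G = l1 G + INR N1 * h)
    by (rewrite Eh; unfold mesh_size; field; lra).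
  assert (E34 : l4 G = l3 G + INR (Defs.N0 G * N1) * h).
  { rewrite mult_INR. assert (E := aspect_ratio G).
    replace (l4 G) with (l3 G + INR (Defs.N0 G) * (l2 G - l1 G)) by lra.
    rewrite E12. ring. }
  assert (Hstep : forall k, 0 < INR k * h -> 1 <= INR k).
  { intros k Hk. replace 1 with (INR 1) by reflexivity. apply le_INR.
    destruct k; [simpl in Hk; lra|lia]. }
  assert (Hup : forall k N, INR k * h < INR N * h -> INR k + 1 <= INR N).
  { intros k N Hk. rewrite <- S_INR. apply le_INR.
    apply Rmult_lt_reg_r in Hk; auto. now apply INR_lt in Hk. }
  assert (A1 := Hstep i ltac:(lra)). assert (A2 := Hstep j ltac:(lra)).
  assert (A3 := Hup i N1 ltac:(lra)). assert (A4 := Hup j (Defs.N0 G * N1)%nat ltac:(lra)).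
  apply (Rmult_le_compat_r h) in A1, A2, A3, A4; lra.
Qed.

Lemma stencil_point_fine G w : 0 < w < 1 -> arbitrarily_fine (stencil_point G w).
Proof.
  intros Hw delta Hdelta.
  assert (Hxi := xi_inside G). assert (Hz := zeta_inside G).
  set (r := Rmin (xi G - l1 G) (l2 G - xi G)).
  set (s := Rmin (l4 G - zeta G) delta).
  assert (Hr1 := Rmin_l (xi G - l1 G) (l2 G - xi G)).
  assert (Hr2 := Rmin_r (xi G - l1 G) (l2 G - xi G)).
  assert (Hs1 := Rmin_l (l4 G - zeta G) delta).
  assert (Hs2 := Rmin_r (l4 G - zeta G) delta).
  fold r in Hr1, Hr2. fold s in Hs1, Hs2.
  assert (Hr : 0 < r) by (apply Rmin_pos; lra).
  assert (Hs : 0 < s) by (apply Rmin_pos; lra).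
  set (h := Rmin r s / 2).
  assert (H1 := Rmin_l r s). assert (H2 := Rmin_r r s).
  assert (H3 : 0 < Rmin r s) by now apply Rmin_pos.
  assert (Eh : Rmin r s = 2 * h) by (unfold h; field).
  assert (Hwh : 0 < w * h < h) by nra.
  (* The step is at most half the distance from xi to either vertical side, which leaves room for x
     - h and x + h, and at most half of l4 - zeta, so that the midpoint ordinate keeps distance h
     from both zeta and l4. *)
  exists h, (xi G + w * h), ((zeta G + l4 G) / 2).
  split; [lra|]. split; [|split].
  - lra.
  - split; lra.
  - intros [_ H]. apply Rabs_def2 in H. lra.
Qed.

(** When meshes with such points are not arbitrarily fine, consistency on them is vacuous for small
    h and every stencil passes, so uniqueness on meshes is conditional. With free steps fine
    configurations exist for every w, and uniqueness is unconditional. Consistency is proved for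
    free steps and restricted to meshes. *)
Theorem theorem2p4 :
  forall (G : geometry) (a : R -> R -> R) (ap : index -> R) (w : R),
    coefficient G a ap ->
    0 < w < 1 ->
    let alpha := ap I1 / ap I2 in
    let C := stencil alpha w in
    0 < alpha /\ 0 < beta alpha w /\
    consistent 4 (mesh_point G w) G a ap w C /\
    (arbitrarily_fine (mesh_point G w) ->
       forall C' : Z -> Z -> R,
         consistent 4 (mesh_point G w) G a ap w C' -> proportional C' C) /\
    consistent 4 (stencil_point G w) G a ap w C /\
    (forall C' : Z -> Z -> R,
       consistent 4 (stencil_point G w) G a ap w C' -> proportional C' C).
Proof.
  intros G a ap w Ha Hw alpha C.
  assert (Hal : 0 < alpha)
    by (apply Rdiv_lt_0_compat; now apply (coefficient_pos G a)).
  assert (Hcons := stencil_consistent G a ap w Ha Hw).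
  split; [exact Hal|]. split; [now apply beta_pos|].
  split; [|split; [|split]].
  - apply consistent_imp with (2 := Hcons). apply mesh_stencil_point.
  - intros Hfine C' HC'.
    apply (consistent_proportional (mesh_point G w) G a); auto.
    apply mesh_stencil_point.
  - exact Hcons.
  - intros C' HC'.
    apply (consistent_proportional (stencil_point G w) G a); auto.
    now apply stencil_point_fine.
Qed.
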